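(* Let $(\Gamma,\pi)$ be a weighted graph with $\Gamma=(G,E)$, and let $(\alpha(e))_{e\in E}$ be positive edge weights adapted to the VSRW on $(\Gamma,\pi)$ such that there exists $D_\alpha>0$ satisfying $\alpha(e)\le D_\alpha$ for all $e\in E$. Let $\rho$ be any metric on $G$ satisfying $\rho(x,y)\le d_\alpha(x,y)$ for all $x,y\in G$. If there exist $x_0\in G$ and $r_0>0$ such that $$\int_{r_0}^\infty\frac{r}{\log m_G(B_\rho(x_0,r))}\,dr=+\infty,$$ then $(\Gamma,\pi)$ is stochastically complete.
   Context: $\Gamma=(G,E)$ is an unoriented, connected, finite or countably infinite, locally finite graph without loops or multiple edges; $x\sim y$ means $\{x,y\}\in E$. A weighted graph $(\Gamma,\pi)$ has symmetric nonnegative edge weights $\pi_{xy}=\pi_{yx}$, with $\pi_{xy}>0$ if and only if $\{x,y\}\in E$; for $e=\{x,y\}$ write $\pi(e)=\pi_{xy}$; $E(x)$ is the set of edges incident to $x$. The variable-speed random walk (VSRW) is the (possibly exploding) continuous-time Markov chain $(X_t)_{t\ge 0}$ on $G$ with generator $(\mathcal L_Xf)(x)=\sum_{y\sim x}\pi_{xy}(f(y)-f(x))$. With $p_t(x,y)=\mathbb P^x(X_t=y)$, $(\Gamma,\pi)$ is stochastically complete if $\sum_{y\in G}p_t(x,y)=1$ for all $t\ge 0$ and $x\in G$; equivalently, $X$ almost surely does not explode. The edge weights $(\alpha(e))_{e\in E}$ are adapted to the VSRW if there is $C_\alpha\ge0$ with $\sum_{e\in E(x)}\pi(e)\alpha^2(e)\le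 C_\alpha$ for every $x\in G$. The metric induced by the edge weights is $d_\alpha(x,y)=\inf\{\sum_{e\in\gamma}\alpha(e)^{1/2}:\gamma\text{ is a path joining }x\text{ and }y\}$; equivalently, $d_\alpha(x,y)=\sup|f(x)-f(y)|$ over all $f:G\to\mathbb R$ with $(f(u)-f(v))^2\le\alpha(e)$ for every edge $e=\{u,v\}\in E$. $B_\rho(x,r)$ is the closed ball $\{y\in G:\rho(x,y)\le r\}$, and $m_G(U)=|U|$ is counting measure on $G$.
   Formalization: With edge lengths α(e)^{1/2}, the condition Σπ(e)α²(e) ≤ C makes the claim false (on N: π=(n+1)^3, α=(n+1)^{-3/2}), so ''adapted'' is taken as Σπ(e)α(e) ≤ C; where the ball is a single point (log = 0) the undefined integrand is set to 0. *)

(* Defs.v *)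
From HB Require Import structures.
From mathcomp Require Import all_boot all_order all_algebra.
From mathcomp Require Import all_classical all_reals all_analysis.
From mathcomp Require Import measurable_realfun.

Set Implicit Arguments.
Unset Strict Implicit.
Unset Printing Implicit Defensive.

Import Order.TTheory GRing.Theory Num.Theory.
Import numFieldNormedType.Exports.

Local Open Scope classical_set_scope.
Local Open Scope ring_scope.

Record weighted_graph (R : realType) (G : countType) := WeightedGraph {
  adj : rel G;
  adj_sym : symmetric adj;
  adj_irr : irreflexive adj;
  adj_locally_finite : forall x, finite_set [set y | adj x y];
  adj_connected : forall x y, exists2 p : seq G, path adj x p & last x p = y;
  weight : G -> G -> R;
  weight_sym : forall x y, weight x y = weight y x;
  weight_ge0 : forall x y, 0 <= weight x y;
  weight_gt0 : forall x y, (0 < weight x y) = adj x y }.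

Section graph.
Variables (R : realType) (G : countType) (Gamma : weighted_graph R G).

Definition nbrs (x : G) : set G := [set y | adj Gamma x y].

Definition generator (f : G -> R) (x : G) : R :=
  \sum_(y \in nbrs x) weight Gamma x y * (f y - f x).

(* The matrix of the generator: weight x y off the diagonal, and minus the
   total weight at x on the diagonal. *)
Definition qmatrix (x y : G) : R := generator (fun z => (z == y)%:R) x.

Definition exit_rate (x : G) : R := - qmatrix x x.

(* A state with exit rate 0 is absorbing; by connectedness this only happens
   when G is a single vertex. *)
Definition jump_prob (x y : G) : R :=
  if exit_rate x == 0 then (x == y)%:R
  else if x == y then 0 else qmatrix x y / exit_rate x.

(* The continuous-time Markov chain with the above generator, given by its
   jump chain and holding times.  Under [Prob x] the jump chain starts at x and
   is Markov with transition matrix [jump_prob]; given the jump chain, the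
   holding times are independent and exponential of parameter
   [exit_rate (jump n)] (infinite if this rate is 0).  The field [vsrw_law]
   gives the joint law on a generating pi-system. *)
Record vsrw := VSRW {
  vsrw_display : measure_display;
  Omega : measurableType vsrw_display;
  Prob : G -> probability Omega R;
  jump : nat -> Omega -> G;
  hold : nat -> Omega -> \bar R;
  jump_measurable : forall n y, measurable [set w | jump n w = y];
  hold_measurable : forall n, measurable_fun [set: Omega] (hold n);
  hold_ge0 : forall n w, (0 <= hold n w)%E;
  vsrw_law : forall (x : G) (n : nat) (y : nat -> G) (t : nat -> R),
    (forall i, 0 <= t i) ->
    Prob x [set w | forall i, (i <= n)%N ->
                      jump i w = y i /\ ((t i)%:E < hold i w)%E]
    = ((y 0%N == x)%:R * (\prod_(i < n) jump_prob (y i) (y i.+1))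
       * \prod_(i < n.+1) expR (- (exit_rate (y i) * t i)))%:E }.

Definition jump_time (X : vsrw) (n : nat) (w : Omega X) : \bar R :=
  (\sum_(i < n) hold i w)%E.

(* The value is [None] from the explosion time, i.e. the supremum of the jump
   times, onwards. *)
Definition position (X : vsrw) (t : R) (w : Omega X) : option G :=
  let now := [set n | (jump_time n w <= t%:E < jump_time n.+1 w)%E] in
  let n := xget 0%N now in
  if `[< now n >] then Some (jump n w) else None.

Definition transition (X : vsrw) (t : R) (x y : G) : \bar R :=
  Prob X x [set w | position t w = Some y].

Definition stochastically_complete : Prop :=
  forall (X : vsrw) (t : R) (x : G), 0 <= t ->
    \esum_(y in [set: G]) transition X t x y = 1%:E.

(* Positive functions on the set of edges; values off the edges are
   irrelevant. *)
Record is_edge_weight (alpha : G -> G -> R) : Prop := IsEdgeWeight {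
  edge_weight_sym : forall x y, adj Gamma x y -> alpha x y = alpha y x;
  edge_weight_gt0 : forall x y, adj Gamma x y -> 0 < alpha x y }.

(* In [induced_dist] an edge e has length sqrt (alpha e), so [alpha e] is a
   squared length and enters the adaptedness condition with exponent 1.
   Exponent 2 here would require lengths [alpha e], and is wrong with lengths
   sqrt (alpha e): on the half-line nat with weight (n+1)^3 on {n, n+1} and
   alpha = (n+1)^(-3/2), the sums of weight * alpha^2 are at most 2 and balls
   of radius r have about (r/4)^4 points, but the walk explodes, since the mean
   time to go from n to n+1 is (n+1)^(-2). *)
Definition adapted (alpha : G -> G -> R) : Prop :=
  exists2 C : R, 0 <= C &
    forall x, \sum_(y \in nbrs x) weight Gamma x y * alpha x y <= C.

Definition path_length (alpha : G -> G -> R) (x : G) (p : seq G) : R :=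
  \sum_(e <- zip (x :: p) p) Num.sqrt (alpha e.1 e.2).

Definition induced_dist (alpha : G -> G -> R) (x y : G) : R :=
  inf [set path_length alpha x p |
        p in [set p | path (adj Gamma) x p /\ last x p = y]].

End graph.

Record is_metric (R : realType) (G : Type) (rho : G -> G -> R) : Prop :=
  IsMetric {
  metric_ge0 : forall x y, 0 <= rho x y;
  metric_eq0 : forall x y, rho x y = 0 <-> x = y;
  metric_sym : forall x y, rho x y = rho y x;
  metric_triangle : forall x y z, rho x z <= rho x y + rho y z }.

Definition mball (R : realType) (G : Type) (rho : G -> G -> R)
  (x : G) (r : R) : set G := [set y | rho x y <= r].

(* r / log |B(x, r)|, with value 0 for an infinite ball (r / +oo), and also for
   a ball reduced to its centre, where the quotient r / 0 is undefined.  With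
   the value +oo in the latter case, any r0 smaller than the distance from x to
   the other vertices would make the integral infinite on every graph. *)
Definition volume_quotient (R : realType) (G : countType) (rho : G -> G -> R)
  (x : G) (r : R) : \bar R :=
  let l := lne (counting (mball rho x r) : \bar R) in
  (if l == 0 then 0 else r%:E / l)%E.

(* Main.v *)
(* If the walk explodes, v(x) = E^x[exp (- explosion time)] is a nonzero function with
   0 <= v <= 1 and L v = v; so it suffices to exclude such functions.  Scale v to w with
   supremum 1 and let d = rho x0.  Interpolate d linearly along every edge, and w by a parabola
   of second derivative 2 c alpha(e); adaptedness makes the vertex terms of the integration by
   parts absorb the bending as soon as w >= 1/2.  Test the resulting subsolution on the
   metric graph against a nonnegative function g(w, d) vanishing for w <= 1/2 and for large d:
   completing the square in the derivative of w along the edges, the test gives a contradiction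
   if 2 c g - g_d ^ 2 / (4 g_w) is nonnegative up to a small error.  Such a g is a sum of
   products cap(w - s_k) ^ m_k * (1 - d / r_k)_+ ^ (16 m_k) over geometric scales r_k = 16 ^ k,
   where m_k is about log_2 |B(x0, r_k)|.  The k-th term makes up for the failure of the previous
   one at the price of raising the level s_k by about r_k ^ 2 / m_k; the divergence of the
   integral lets the levels run from 1/2 to 1 in finitely many steps. *)
Require Import Defs.
From mathcomp Require Import all_boot all_order all_algebra.
From mathcomp Require Import all_classical all_reals all_analysis.
From mathcomp Require Import measurable_realfun.
From mathcomp Require Import ring lra zify.
Import Order.TTheory GRing.Theory Num.Theory.
Import numFieldNormedType.Exports.
Local Open Scope classical_set_scope.
Local Open Scope ring_scope.
Set Implicit Arguments.
Unset Strict Implicit.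
Unset Printing Implicit Defensive.

(** The exponents balance as follows, with m the exponent of a scale and m' >= 2 m that of the next
    one. Each product is weighted by 2^(9m). Where w is above the middle of its level interval and d
    <= r / 16, the product is at least 2^(-4m), so the weighted term is at least 2^(5m). Where w is
    above the interval, completing the square costs at most c 2^m, or c 2^(10m) with the weight;
    there the next term is at least 2^(5m') >= 2^(10m). Where d > r / 2, the exponent 16 m of the
    cutoff brings the cost down to c 2^(10m - 16m) = c 2^(-6m); the ball has at most 2^m points, so
    the total c 2^(-5m) is negligible against the value of g at a single point. On the side of the
    walk, the law is given only on events prescribing the first jumps and lower bounds for the
    holding times. The mean of exp (- jump time) is therefore approached through step functions of
    the holding times, whose products expand into finitely many indicators of such events. *)

Ltac nonneg := repeat (first [assumption | (apply: ltW; assumption) | exact: ler01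
  | (apply: mulr_ge0) | (rewrite invr_ge0) | (apply: exprn_ge0) | (apply: addr_ge0) | exact: ler0n ]).

(** * Derivatives of real functions, and gluing at a zero *)

Section pointwise_derivatives.
Variables (R : realType) (f g : R -> R) (x df dg : R).

Lemma is_derive_fctX (n : nat) : is_derive x (1 : R) f df ->
  is_derive x (1 : R) (fun y => f y ^+ n) (n%:R * f x ^+ n.-1 * df).
Proof.
move=> ?; rewrite (_ : (fun y => _) = f ^+ n); first exact: is_deriveX.
by apply/funext => y; rewrite exprfctE.
Qed.

Lemma is_derive_fctM : is_derive x (1 : R) f df -> is_derive x (1 : R) g dg ->
  is_derive x (1 : R) (fun y => f y * g y) (f x * dg + g x * df).
Proof. exact: is_deriveM. Qed.

Lemma is_derive_fctD : is_derive x (1 : R) f df -> is_derive x (1 : R) g dg ->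
  is_derive x (1 : R) (fun y => f y + g y) (df + dg).
Proof. exact: is_deriveD. Qed.

Lemma is_derive_fctZ (k : R) : is_derive x (1 : R) f df ->
  is_derive x (1 : R) (fun y => k * f y) (k * df).
Proof. exact: is_deriveZ. Qed.

Lemma is_derive_fctV : f x != 0 -> is_derive x (1 : R) f df ->
  is_derive x (1 : R) (fun y => (f y)^-1) (- (f x) ^- 2 * df).
Proof.
move=> f0 [fd <-]; apply: DeriveDef; first exact: derivableV.
by rewrite deriveV.
Qed.

End pointwise_derivatives.

(** By the quadratic bound the difference quotient at 0 is O(h), so the two pieces glue with
    derivative 0. This is why the powers below have exponent at least 2. *)
Lemma is_derive_pos_part (R : realType) (F F' : R -> R) (K : R) :
  (forall x : R, x <= 0 -> F x = 0) ->
  (forall x : R, 0 < x <= 1 -> `|F x| <= K * x ^+ 2) ->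
  (forall x : R, 0 < x -> is_derive x (1 : R) F (F' x)) ->
  forall x : R, is_derive x (1 : R) F (if 0 < x then F' x else 0).
Proof.
move=> F0 FK dF x; case: ltgtP => [x0|x0|<-].
- exact: dF.
- apply: (@near_eq_is_derive _ _ _ (cst 0)).
  near=> y; rewrite F0 //=; apply: ltW; near: y.
  exact: lt_nbhsl.
- have cv : h^-1 *: ((F \o shift 0) (h *: (1 : R)) - F 0) @[h --> 0^'] --> (0 : R).
    apply/cvgrPdist_le => e e0; near=> h.
    rewrite sub0r normrN /= addr0 (F0 0 (lexx _)) subr0 /GRing.scale /= mulr1.
    have h0 : h != 0 by near: h; exact: nbhs_dnbhs_neq.
    have [hn|hp] := leP h 0; first by rewrite F0 // mulr0 normr0 ltW.
    rewrite normrM normfV (gtr0_norm hp) ler_pdivrMl //.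
    have h1 : h <= 1.
      by rewrite -(gtr0_norm hp); near: h; exact: dnbhs0_le.
    have /FK/le_trans -> // : 0 < h <= 1 by rewrite hp.
    rewrite expr2 mulrCA ler_pM2l //.
    have h2 : `|h| <= e / (`|K| + 1).
      near: h; apply: dnbhs0_le; rewrite divr_gt0 //.
    rewrite gtr0_norm // in h2.
    have K1 : 0 < `|K| + 1 by rewrite ltr_wpDl.
    rewrite ler_pdivlMr // in h2; apply: le_trans h2.
    rewrite mulrC ler_pM2l //.
    by rewrite (le_trans (ler_norm _)) // lerDl.
  by apply: DeriveDef; [apply/cvg_ex; exists 0|exact: cvg_lim cv].
Unshelve. all: by end_near. Qed.

(** * One product of the test function, at a single scale *)

Section test_function.
Variable R : realType.
Implicit Types (m : nat) (r dl s w d u : R).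

Lemma is_derive_pos_partX m (x : R) :
  is_derive x (1 : R) (fun y => Num.max y 0 ^+ m.+2)
    (m.+2%:R * Num.max x 0 ^+ m.+1).
Proof.
have -> : m.+2%:R * Num.max x 0 ^+ m.+1 =
    if 0 < x then m.+2%:R * x ^+ m.+1 else 0.
  by case: (ltrP 0 x) => x0; rewrite // expr0n mulr0.
apply: (@is_derive_pos_part _ _ (fun x => m.+2%:R * x ^+ m.+1) 1).
- by move=> {}x x0; rewrite max_r // expr0n.
- move=> {}x /andP[x0 x1]; have x0' := ltW x0.
  by rewrite mul1r max_l // ger0_norm ?exprn_ge0 // ler_wiXn2l.
- move=> {}x x0; apply: (@near_eq_is_derive _ _ _ (fun y : R => y ^+ m.+2)).
    near=> y; rewrite max_l //; apply: ltW; near: y; exact: lt_nbhsr.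
  have := is_derive_fctX m.+2 (is_derive_id x (1 : R)).
  by rewrite mulr1.
Unshelve. all: by end_near. Qed.

(* Unlike u / dl, powers of [cap dl u] stay bounded when u is much larger than dl. *)
Definition cap dl u : R := Num.max u 0 / (Num.max u 0 + dl).

Lemma cap_ge0 dl u : 0 < dl -> 0 <= cap dl u.
Proof.
by move=> dl0; rewrite divr_ge0 ?addr_ge0 ?le_max ?lexx ?orbT// ltW.
Qed.

Lemma cap_le1 dl u : 0 < dl -> cap dl u <= 1.
Proof.
move=> dl0; have u0 : 0 <= Num.max u 0 by rewrite le_max lexx orbT.
by rewrite ler_pdivrMr ?ltr_wpDl// mul1r lerDl ltW.
Qed.

Lemma is_derive_capX m dl (x : R) : 0 < dl ->
  is_derive x (1 : R) (fun y => cap dl y ^+ m.+2)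
    (m.+2%:R * cap dl x ^+ m.+1 * (dl / (Num.max x 0 + dl) ^+ 2)).
Proof.
move=> dl0.
have -> : m.+2%:R * cap dl x ^+ m.+1 * (dl / (Num.max x 0 + dl) ^+ 2) =
    if 0 < x then m.+2%:R * (x / (x + dl)) ^+ m.+1 * (dl / (x + dl) ^+ 2) else 0.
  by rewrite /cap; case: (ltrP 0 x) => x0; rewrite // mul0r expr0n mulr0 mul0r.
(* The constant comes from [cap dl x <= x / dl] for positive x; since [cap] is at most 1, its higher
   powers are below its square. *)
apply: (@is_derive_pos_part _ _
  (fun x => m.+2%:R * (x / (x + dl)) ^+ m.+1 * (dl / (x + dl) ^+ 2)) (dl ^- 2)).
- by move=> {}x x0; rewrite /cap max_r // mul0r expr0n.
- move=> {}x /andP[x0 x1]; have c0 := cap_ge0 x dl0.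
  rewrite ger0_norm ?exprn_ge0//.
  apply: (@le_trans _ _ (cap dl x ^+ 2)); first by rewrite ler_wiXn2l// cap_le1.
  have x0' := ltW x0.
  rewrite /cap max_l // expr_div_n mulrC ler_pM2r ?exprn_gt0//.
  rewrite lef_pV2 ?posrE ?exprn_gt0 ?addr_gt0// lerXn2r ?nnegrE ?addr_ge0 ?ltW//.
  by rewrite ltrDr.
- move=> {}x x0.
  apply: (@near_eq_is_derive _ _ _ (fun y : R => (y * (y + dl)^-1) ^+ m.+2)).
    near=> y; rewrite /cap max_l //; apply: ltW; near: y; exact: lt_nbhsr.
  have xd : x + dl != 0 by rewrite gt_eqF // addr_gt0.
  have dxd := is_derive_fctD (is_derive_id x (1 : R)) (is_derive_cst dl x (1 : R)).
  have dV := @is_derive_fctV _ (fun y => y + dl) x _ xd dxd.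
  apply: is_derive_eq.
    exact: is_derive_fctX (is_derive_fctM (is_derive_id x (1 : R)) dV).
  by rewrite /=; congr (_ * _); field.
Unshelve. all: by end_near. Qed.

End test_function.

Section test_fun.
Variable R : realType.
Implicit Types (m : nat) (r dl s w d c a X Y : R).

Definition test_fun m r dl s w d : R :=
  cap dl (w - s) ^+ m * Num.max (1 - d / r) 0 ^+ (16 * m).

Definition test_fun_dw m r dl s w d : R :=
  m%:R * cap dl (w - s) ^+ m.-1 * (dl / (Num.max (w - s) 0 + dl) ^+ 2) *
  Num.max (1 - d / r) 0 ^+ (16 * m).

Definition test_fun_dd m r dl s w d : R :=
  - (cap dl (w - s) ^+ m *
     ((16 * m)%:R * Num.max (1 - d / r) 0 ^+ (16 * m).-1 / r)).

Lemma is_derive_bump m r dl s (W D : R -> R) (x dW dD : R) :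
  (1 < m)%N -> 0 < dl ->
  is_derive x (1 : R) W dW -> is_derive x (1 : R) D dD ->
  is_derive x (1 : R) (fun y => test_fun m r dl s (W y) (D y))
    (test_fun_dw m r dl s (W x) (D x) * dW + test_fun_dd m r dl s (W x) (D x) * dD).
Proof.
case: m => [//|[//|m]] _ dl0 hW hD; rewrite /test_fun /test_fun_dw /test_fun_dd.
have hn : (16 * m.+2 = (16 * m + 30).+2)%N by lia.
rewrite hn.
have h1 : is_derive x (1 : R) (fun y => W y - s) dW.
  by rewrite -[dW]addr0; apply: is_derive_fctD => //; exact: is_derive_cst.
have h2 : is_derive x (1 : R) (fun y => 1 - D y / r) (- (dD / r)).
  rewrite (_ : - (dD / r) = 0 + (- r^-1) * dD); last by rewrite add0r mulNr mulrC.
  rewrite (_ : (fun y => _) = (fun y => (cst 1) y + (- r^-1) * D y)).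
    exact: is_derive_fctD (is_derive_cst _ _ _) (is_derive_fctZ _ hD).
  by apply/funext => y; rewrite /= mulNr mulrC.
have h3 := @is_derive1_comp _ _ (fun y => W y - s) x _ _ (is_derive_capX m (W x - s) dl0) h1.
have h4 := @is_derive1_comp _ _ (fun y => 1 - D y / r) x _ _
  (is_derive_pos_partX (16 * m + 30) (1 - D x / r)) h2.
have h5 := is_derive_fctM h3 h4; rewrite /comp in h5. apply: is_derive_eq.
by rewrite /=; ring.
Qed.

Lemma test_fun_ge0 m r dl s w d : 0 < dl -> 0 <= test_fun m r dl s w d.
Proof.
by move=> dl0; rewrite mulr_ge0 ?exprn_ge0 ?cap_ge0 // le_max lexx orbT.
Qed.

Lemma test_fun_eq0 m r dl s w d : (0 < m)%N -> w <= s \/ r <= d -> 0 < r ->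
  test_fun m r dl s w d = 0.
Proof.
rewrite /test_fun; case: m => // m _ [ws|rd] r0.
  by rewrite /cap max_r ?subr_le0 // mul0r expr0n mul0r.
rewrite [X in _ * X ^+ _]max_r; first by rewrite expr0n muln_eq0 mulr0.
by rewrite subr_le0 ler_pdivlMr // mul1r.
Qed.

(** Expand [(2 * A * X - B * Y) ^+ 2 >= 0] and divide by [4 * A]. With A = g_w and B = - g_d, Q is
    the loss g_d^2 / (4 g_w). *)
Lemma square_completion a A B Q X Y : 0 < A -> 0 <= Q ->
  B ^+ 2 = 4 * A * Q -> Y ^+ 2 <= a -> - (a * Q) <= X ^+ 2 * A + X * Y * - B.
Proof.
move=> A0 Q0 BQ Ya.
have h1 : Y ^+ 2 * Q <= a * Q by rewrite ler_wpM2r.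
have h2 : 0 <= (2 * A * X - B * Y) ^+ 2 by rewrite sqr_ge0.
have h3 : (2 * A * X - B * Y) ^+ 2 = 4 * A * (X ^+ 2 * A - X * Y * B + Y ^+ 2 * Q).
  have -> : (2 * A * X - B * Y) ^+ 2 =
    4 * A ^+ 2 * X ^+ 2 - 4 * A * X * B * Y + B ^+ 2 * Y ^+ 2 by ring.
  by rewrite BQ; ring.
rewrite h3 pmulr_rge0 ?mulr_gt0 // in h2.
lra.
Qed.

(* Completing the square in X = W' bounds the mixed term by dd^2 / (4 dw). *)
Lemma test_fun_ineq m r dl s w d c a X Y :
  (1 < m)%N -> 0 < r -> 0 < dl -> dl <= 1 / 2 -> 1 / 2 <= s -> w <= 1 ->
  0 <= d -> 0 <= c -> 512 * m%:R * dl <= c * r ^+ 2 -> Y ^+ 2 <= a ->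
  a * (c * test_fun m r dl s w d
       - 256 * m%:R / (dl * r ^+ 2) * ((s + dl < w)%R && (d < r)%R)%:R
       - 256 * m%:R / (dl * r ^+ 2) * 2 ^- (16 * m) * (d < r)%R%:R) <=
  2 * c * a * test_fun m r dl s w d + X ^+ 2 * test_fun_dw m r dl s w d
   + X * Y * test_fun_dd m r dl s w d.
Proof.
move=> m1 r0 dl0 dl2 s2 w1 d0 c0 hdl Ya.
have m0n : (0 < m)%N by exact: ltnW.
have m1n : (m.-1 == 0)%N = false by rewrite -subn1 subn_eq0 leqNgt m1.
have m16 : (16 * m == 0)%N = false by rewrite muln_eq0 /= gtn_eqF.
have m16' : ((16 * m).-1 == 0)%N = false.
  by rewrite -subn1 subn_eq0 leqNgt (leq_trans m1) // leq_pmull.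
have a0 : 0 <= a by apply: le_trans Ya; rewrite sqr_ge0.
have m0 : 0 < m%:R :> R by rewrite ltr0n.
set P := 256 * m%:R / (dl * r ^+ 2).
have dl0' := ltW dl0; have r0' := ltW r0; have m0' := ltW m0.
have c256 : 0 <= 256 :> R by exact: ler0n.
have c64 : 0 <= 64 :> R by exact: ler0n.
have P0 : 0 <= P.
  by apply: divr_ge0; apply: mulr_ge0 => //; exact: exprn_ge0.
have g0 := test_fun_ge0 m r s w d dl0.
have E0 : 0 <= P * 2 ^- (16 * m) by rewrite mulr_ge0 // invr_ge0 exprn_ge0.
have thz : r <= d -> Num.max (1 - d / r) 0 = 0.
  by move=> rd; rewrite max_r // subr_le0 ler_pdivlMr // mul1r.
have zero : w <= s \/ r <= d ->
   [/\ test_fun m r dl s w d = 0, test_fun_dw m r dl s w d = 0 & test_fun_dd m r dl s w d = 0].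
  move=> h; split; first exact: test_fun_eq0.
  - rewrite /test_fun_dw; case: h => h.
      rewrite /cap max_r ?subr_le0 // mul0r expr0n.
      by rewrite m1n ?mulr0 ?mul0r.
    rewrite thz //.
    by rewrite expr0n m16 mulr0.
  - rewrite /test_fun_dd; case: h => h.
      rewrite /cap max_r ?subr_le0 // mul0r expr0n.
      by rewrite gtn_eqF // mul0r oppr0.
    rewrite thz //.
    by rewrite expr0n m16' ?(mulr0,mul0r,oppr0).
have [ws|sw] := leP w s.
  have [-> -> ->] := zero (or_introl ws).
  rewrite !mulr0 !addr0 sub0r -opprD; apply: mulr_ge0_le0 => //.
  rewrite oppr_le0; apply: addr_ge0; apply: mulr_ge0 => //; exact: ler0n.
have [rd|dr] := leP r d.
  have [-> -> ->] := zero (or_intror rd).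
  by rewrite andbF !mulr0 !addr0 !subr0 mulr0.
rewrite andbT mulr1.
set u := w - s; have u0 : 0 < u by rewrite subr_gt0.
set th := 1 - d / r; have th0 : 0 < th by rewrite subr_gt0 ltr_pdivrMr // mul1r.
have th1 : th <= 1 by rewrite lerBlDr lerDl divr_ge0 // ltW.
have uE : Num.max (w - s) 0 = u by rewrite max_l // ltW.
have thE : Num.max (1 - d / r) 0 = th by rewrite max_l // ltW.
set Z := cap dl (w - s) ^+ m.
have ud0 : 0 < u + dl by exact: addr_gt0.
have Z0 : 0 < Z by rewrite exprn_gt0 // /cap uE divr_gt0.
have Z1 : Z <= 1 by rewrite exprn_ile1 ?cap_ge0 ?cap_le1.
set H := th ^+ (16 * m).
have H0 : 0 < H by rewrite exprn_gt0.
have H1 : H <= 1 by rewrite exprn_ile1 // ltW.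
have ge : test_fun m r dl s w d = Z * H by rewrite /test_fun thE.
have gwe : test_fun_dw m r dl s w d = m%:R * Z * H * dl / (u * (u + dl)).
  have eZ : Z = cap dl (w - s) ^+ m.-1 * (u / (u + dl)).
    by rewrite /Z -[in LHS](prednK m0n) exprSr [X in _ * X]/cap uE.
  rewrite /test_fun_dw thE uE -/H eZ.
  by field; rewrite !gt_eqF.
have gde : test_fun_dd m r dl s w d = - (16 * m%:R * Z * H / (r * th)).
  rewrite /test_fun_dd thE -/Z /H.
  have hn : ((16 * m) = (16 * m).-1.+1)%N by rewrite prednK // muln_gt0.
  rewrite [in RHS]hn exprS natrM; field; rewrite !gt_eqF //.
rewrite ge gwe gde.
set Q := 64 * m%:R * (u * (u + dl)) / (dl * r ^+ 2 * th ^+ 2) * (Z * H).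
have main : - (a * Q) <= X ^+ 2 * (m%:R * Z * H * dl / (u * (u + dl)))
    + X * Y * - (16 * m%:R * Z * H / (r * th)).
  set A := m%:R * Z * H * dl / (u * (u + dl)).
  set B := 16 * m%:R * Z * H / (r * th).
  have A0 : 0 < A by apply: divr_gt0; repeat apply: mulr_gt0 => //.
  have BQ : B ^+ 2 = 4 * A * Q.
    by rewrite /A /B /Q; field; rewrite !gt_eqF.
  have Q0 : 0 <= Q.
    by rewrite /Q; nonneg.
  exact: square_completion.
have u2 : u <= 1 / 2.
  by rewrite lerBlDr (le_trans w1) // [leLHS](splitr 1) lerD2l.
have uu : u * (u + dl) <= 1.
  have ud1 : u + dl <= 1 by rewrite [leRHS](splitr 1) lerD.
  by rewrite mulr_ile1 // ?(ltW u0) ?(ltW ud0) // (le_trans u2) // ler_pdivrMr // mul1r ler1n.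
have r20 : 0 < r ^+ 2 by rewrite exprn_gt0.
(* Three regions. If [th >= 1/2] and [u <= dl], the bound on [dl] gives Q <= c g. If [th >= 1/2] and
   [u > dl], only Q <= P is available. If [th < 1/2], two factors [th] cancel the denominator and
   the others give the power of 1/2. *)
have QP : Q <= c * (Z * H) + P * (s + dl < w)%R%:R + P * 2 ^- (16 * m).
  have [th2|th2] := leP (1 / 2) th.
    have thi : 1 <= 4 * th ^+ 2.
      have h2 : 1 <= 2 * th by rewrite mulrC -ler_pdivrMr.
      by rewrite (_ : 4 * th ^+ 2 = (2 * th) ^+ 2) ?exprn_ege1 //; ring.
    have Q1 : Q <= 256 * m%:R * (u * (u + dl)) / (dl * r ^+ 2) * (Z * H).
      rewrite /Q ler_wpM2r ?mulr_ge0 ?(ltW Z0) ?(ltW H0) //.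
      rewrite ler_pdivrMr ?mulr_gt0 ?exprn_gt0 //.
      rewrite [leRHS](_ : _ = (64 * m%:R * (u * (u + dl))) * (4 * th ^+ 2)).
        by rewrite ler_peMr //; nonneg.
      by field; rewrite !gt_eqF.
    have ZH0 : 0 <= Z * H by rewrite mulr_ge0 // ltW.
    have ZH1 : Z * H <= 1 by rewrite mulr_ile1 // ltW.
    case: ltP => sdl /=.
      rewrite mulr1; suff QP : Q <= P.
        by rewrite -addrA; apply: ler_wpDl; [exact: mulr_ge0|apply: ler_wpDr].
      apply: (le_trans Q1); rewrite /P.
      apply: (@le_trans _ _ (256 * m%:R * (u * (u + dl)) / (dl * r ^+ 2))).
        by apply: ler_piMr => [|//]; nonneg.
      rewrite ler_wpM2r ?invr_ge0 ?mulr_ge0 ?(ltW r20) //.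
      by apply: ler_piMr => [|//]; apply: mulr_ge0.
    rewrite mulr0 addr0; suff QP : Q <= c * (Z * H) by exact: ler_wpDr.
    apply: (le_trans Q1); rewrite ler_wpM2r //.
    rewrite ler_pdivrMr ?mulr_gt0 //.
    have udl : u <= dl by rewrite /u lerBlDl.
    have h : u * (u + dl) <= dl * (2 * dl).
      by rewrite mulr_natl mulr2n ler_pM ?lerD2r ?(ltW u0) ?(ltW ud0).
    apply: (@le_trans _ _ (256 * m%:R * (dl * (2 * dl)))).
      by apply: ler_wpM2l h; apply: mulr_ge0.
    rewrite [leLHS](_ : _ = dl * (512 * m%:R * dl)); last by ring.
    by rewrite [leRHS]mulrCA; apply: ler_wpM2l.
  suff QP : Q <= P * 2 ^- (16 * m).
    by apply: ler_wpDl => //; nonneg.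
  have hn : (16 * m = (16 * m - 2).+2)%N.
    by rewrite -[RHS]addn2 subnK // (leq_trans m1) // leq_pmull.
  have e1 : H = th ^+ 2 * th ^+ (16 * m - 2) by rewrite /H -exprD add2n -hn.
  have e2 : th ^+ (16 * m - 2) <= 4 * 2 ^- (16 * m).
    apply: (@le_trans _ _ ((1 / 2) ^+ (16 * m - 2))).
      by rewrite lerXn2r ?nnegrE ?(ltW th0) ?(ltW th2) // divr_ge0.
    rewrite [in leRHS]hn; move: (16 * m - 2)%N => n.
    rewrite expr_div_n expr1n div1r !exprS; rewrite [leLHS](_ : _ = 4 * (2 * (2 * 2 ^+ n))^-1) //.
    by field; rewrite expf_neq0.
  rewrite /Q e1 /P.
  rewrite [leLHS](_ : _ = 64 * m%:R / (dl * r ^+ 2) *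
    (u * (u + dl) * Z * th ^+ (16 * m - 2))); last by field; rewrite !gt_eqF.
  rewrite [leRHS](_ : _ = 64 * m%:R / (dl * r ^+ 2) * (4 * 2 ^- (16 * m))); last first.
    by field; rewrite !gt_eqF // expf_neq0.
  apply: ler_wpM2l; first by nonneg.
  apply: (le_trans _ e2); rewrite ler_piMl ?exprn_ge0 ?(ltW th0) //.
  by apply: mulr_ile1 => //; nonneg.
have := ler_wpM2l a0 QP.
set PP := P * _; set E := P * _; set G := Z * H.
move: main; set M1 := _ * (_ / _); set M2 := _ * - _.
move=> main hQ.
rewrite [leLHS](_ : _ = a * (c * G) - a * PP - a * E); last by ring.
rewrite [2 * c * a * G](_ : _ = 2 * (a * (c * G))); last by ring.
move: hQ; rewrite !mulrDr; lra.
Qed.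

End test_fun.

(** * Sums over scales, and the inequality along one edge *)

Section profile.
Variables (R : realType) (c : R) (m : nat -> nat) (r dl : nat -> R).
Hypothesis c0 : 0 <= c.
Hypothesis m_gt1 : forall k, (1 < m k)%N.
Hypothesis r_gt0 : forall k, 0 < r k.
Hypothesis dl_gt0 : forall k, 0 < dl k.
Hypothesis dl_le : forall k, dl k <= 1 / 2.
Hypothesis dl_r : forall k, 512 * (m k)%:R * dl k <= c * r k ^+ 2.
Hypothesis dl_m : forall k, 256 * (m k)%:R / (dl k * r k ^+ 2) <= c * 2 ^+ m k.

(* The k-th level interval is [T - dl k / 2, T + dl k / 2], and the next one is centred at
   the upper end of the k-th one. *)
Fixpoint wsum (F : nat -> R -> R) (T : R) (ks : seq nat) : R :=
  if ks is k :: ks' then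
    2 ^+ (9 * m k) * F k (T - dl k / 2) + wsum F (T + dl k / 2) ks'
  else 0.

Lemma wsum_lin (a b e : R) (F1 F2 F3 : nat -> R -> R) T ks :
  wsum (fun k s => a * F1 k s + b * F2 k s + e * F3 k s) T ks =
  a * wsum F1 T ks + b * wsum F2 T ks + e * wsum F3 T ks.
Proof.
elim: ks T => [|k ks IH] T /=; first by rewrite !mulr0 !addr0.
by rewrite IH; ring.
Qed.

Definition profile T ks (w d : R) :=
  wsum (fun k s => test_fun (m k) (r k) (dl k) s w d) T ks.
Definition profile_dw T ks (w d : R) :=
  wsum (fun k s => test_fun_dw (m k) (r k) (dl k) s w d) T ks.
Definition profile_dd T ks (w d : R) :=
  wsum (fun k s => test_fun_dd (m k) (r k) (dl k) s w d) T ks.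

Definition tail_error ks (d : R) : R :=
  \sum_(k <- ks) c * 2 ^- (6 * m k) * (d < r k)%R%:R.

Lemma is_derive_profile T ks (W D : R -> R) (x dW dD : R) :
  is_derive x (1 : R) W dW -> is_derive x (1 : R) D dD ->
  is_derive x (1 : R) (fun y => profile T ks (W y) (D y))
    (profile_dw T ks (W x) (D x) * dW + profile_dd T ks (W x) (D x) * dD).
Proof.
move=> hW hD; rewrite /profile /profile_dw /profile_dd.
elim: ks T => [|k ks IH] T /=.
  by rewrite !mul0r addr0; exact: is_derive_cst.
have h1 := is_derive_fctZ (2 ^+ (9 * m k))
  (is_derive_bump (r k) (T - dl k / 2) (m_gt1 k) (dl_gt0 k) hW hD).
have h2 := is_derive_fctD h1 (IH (T + dl k / 2)).
by apply: is_derive_eq; ring.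
Qed.

Lemma profile_ge0 T ks w d : 0 <= profile T ks w d.
Proof.
rewrite /profile; elim: ks T => //= k ks IH T.
by rewrite addr_ge0 // mulr_ge0 ?exprn_ge0 // test_fun_ge0.
Qed.

(** Since [T >= 3/4] and [dl k <= 1/2], every level interval lies above 1/2. *)
Lemma profile_eq0 T ks w d : 3 / 4 <= T -> w <= 1 / 2 \/ (forall k, k \in ks -> r k <= d) ->
  profile T ks w d = 0.
Proof.
rewrite /profile; elim: ks T => //= k ks IH T T0 h.
rewrite IH.
- rewrite addr0 test_fun_eq0 ?mulr0 //; first exact: ltnW.
  case: h => h; last by right; apply: h; rewrite mem_head.
  by left; apply: (le_trans h); have := dl_le k; lra.
- by apply: (le_trans T0); rewrite lerDl divr_ge0 // ltW.
- by case: h => h; [left|right => j jks; apply: h; rewrite inE jks orbT].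
Qed.

(** [u / (u + e)] increases with u and equals 1/3 at [u = e / 2], while (15/16)^16 >= 3/16 by
    repeated squaring; the product of the two bounds is 2^(-4). *)
Lemma test_fun_lb (n : nat) (e rho s w d : R) : 0 < e -> 0 < rho -> 0 <= d ->
  s + e / 2 <= w -> 16 * d <= rho -> 2 ^- (4 * n) <= test_fun n rho e s w d.
Proof.
move=> e0 rho0 d0 sw dr; rewrite /test_fun.
have c3 : 1 / 3 <= cap e (w - s).
  have u0 : 0 < w - s by rewrite subr_gt0; lra.
  rewrite /cap max_l ?(ltW u0) // (ler_pdivlMr _ _ (addr_gt0 u0 e0)); lra.
have t15 : 15 / 16 <= Num.max (1 - d / rho) 0.
  rewrite le_max; apply/orP; left.
  have : d / rho <= 1 / 16 by rewrite ler_pdivrMr //; lra.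
  lra.
have b2 : (15 / 16 : R) ^+ 2 >= 7 / 8 by rewrite expr2; lra.
have b4 : (15 / 16 : R) ^+ 4 >= 3 / 4.
  rewrite (exprM _ 2 2).
  have : (7 / 8 : R) ^+ 2 <= ((15 / 16) ^+ 2) ^+ 2 by rewrite lerXn2r ?nnegrE ?exprn_ge0 ?divr_ge0.
  move: (((15 / 16) ^+ 2) ^+ 2 : R) => z; rewrite expr2; lra.
have b16 : (15 / 16 : R) ^+ 16 >= 3 / 16.
  rewrite (exprM _ 4 4).
  have : (3 / 4 : R) ^+ 4 <= ((15 / 16) ^+ 4) ^+ 4 by rewrite lerXn2r ?nnegrE ?exprn_ge0 ?divr_ge0.
  move: (((15 / 16) ^+ 4) ^+ 4 : R) => z; rewrite !exprS expr0; lra.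
rewrite !exprM -exprMn -exprVn.
have v16 : ((2 : R) ^+ 4)^-1 = 1 / 16 by rewrite !exprS expr0; field.
have c0' := cap_ge0 (w - s) e0.
have t0 : 0 <= Num.max (1 - d / rho) 0 by rewrite le_max lexx orbT.
rewrite v16 lerXn2r ?nnegrE ?divr_ge0 //; first by nonneg.
apply: (@le_trans _ _ (1 / 3 * (3 / 16))); first lra.
apply: ler_pM => //; try lra.
by apply: (le_trans b16); rewrite lerXn2r ?nnegrE ?divr_ge0.
Qed.

Definition scale_step k k' := (2 * m k <= m k')%N && (16 * r k <= r k').

(** Induction on the scales: the loss of the first one, for w above its level interval, is paid by
    the surplus c g of the second. The last scale has no such loss, because the hypothesis on the
    sum of the [dl j] puts the upper end of its interval at 1 or above. *)
Lemma profile_ineq k ks T w d a X Y :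
  path scale_step k ks -> 3 / 4 <= T ->
  1 <= T + \sum_(j <- k :: ks) dl j / 2 ->
  w <= 1 -> 0 <= d -> Y ^+ 2 <= a ->
  a * (c * 2 ^+ (9 * m k) * test_fun (m k) (r k) (dl k) (T - dl k / 2) w d
       - tail_error (k :: ks) d) <=
  2 * c * a * profile T (k :: ks) w d + X ^+ 2 * profile_dw T (k :: ks) w d
   + X * Y * profile_dd T (k :: ks) w d.
Proof.
move=> + + + w1 d0 Ya; have a0 : 0 <= a by apply: le_trans Ya; rewrite sqr_ge0.
rewrite /profile /profile_dw /profile_dd -wsum_lin.
have one j T' : 3 / 4 <= T' ->
  a * (c * 2 ^+ (9 * m j) * test_fun (m j) (r j) (dl j) (T' - dl j / 2) w d
      - c * 2 ^+ (10 * m j) * ((T' + dl j / 2 < w)%R && (d < r j)%R)%:R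
      - c * 2 ^- (6 * m j) * (d < r j)%R%:R) <=
  2 ^+ (9 * m j) * (2 * c * a * test_fun (m j) (r j) (dl j) (T' - dl j / 2) w d +
    X ^+ 2 * test_fun_dw (m j) (r j) (dl j) (T' - dl j / 2) w d +
    X * Y * test_fun_dd (m j) (r j) (dl j) (T' - dl j / 2) w d).
  move=> hT; have s2 : 1 / 2 <= T' - dl j / 2 by have := dl_le j; lra.
  have := test_fun_ineq X (m_gt1 j) (r_gt0 j) (dl_gt0 j) (dl_le j) s2 w1 d0 c0 (dl_r j) Ya.
  have -> : T' - dl j / 2 + dl j = T' + dl j / 2 by lra.
  have p9 : 0 <= (2 : R) ^+ (9 * m j) by rewrite exprn_ge0.
  move=> /(ler_wpM2l p9); apply: le_trans.
  rewrite [leRHS]mulrCA ler_wpM2l // !mulrBr.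
  set b := test_fun _ _ _ _ _ _; set P := 256 * _ / _; set u := (_ && _)%:R; set v := (d < r j)%R%:R.
  have u0 : 0 <= u by rewrite ler0n.
  have v0 : 0 <= v by rewrite ler0n.
  have hP : 2 ^+ (9 * m j) * P <= c * 2 ^+ (10 * m j).
    rewrite (_ : 10 * m j = m j + 9 * m j)%N; last by rewrite -mulSn.
    by rewrite exprD mulrA mulrC ler_wpM2r // dl_m.
  have e16 : c * 2 ^+ (10 * m j) * 2 ^- (16 * m j) = c * 2 ^- (6 * m j).
    rewrite (_ : 16 * m j = 10 * m j + 6 * m j)%N; last by rewrite -mulnDl.
    by rewrite exprD; field; rewrite !expf_neq0.
  rewrite (mulrA _ P u) (mulrA _ (P * _) v) (mulrA _ P) -e16 (mulrA _ c b) (mulrC _ c).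
  apply: lerB; first apply: lerB => //.
    by rewrite ler_wpM2r.
  by rewrite ler_wpM2r // ler_wpM2r // invr_ge0 exprn_ge0.
elim: ks k T => [|k' ks IH] k T /=.
  rewrite /tail_error !big_seq1 => _ T0 T1.
  have := one k T T0; rewrite [(_ < w)]ltNge (le_trans w1) //= mulr0 subr0 addr0.
  by [].
move=> /andP[/andP[mk rk] pk] T0.
rewrite big_cons addrA => T1.
have T0' : 3 / 4 <= T + dl k / 2.
  by apply: (le_trans T0); rewrite lerDl divr_ge0 // ltW.
have := lerD (one k T T0) (IH k' _ pk T0' T1); apply: le_trans.
rewrite /= -mulrDr ler_wpM2l // /tail_error [in leLHS]big_cons.
set b := test_fun (m k) _ _ _ _ _; set b' := test_fun (m k') _ _ _ _ _.
set e := _ * (d < r k)%R%:R; set ee := \sum_(j <- _) _.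
suff : c * 2 ^+ (10 * m k) * ((T + dl k / 2 < w)%R && (d < r k)%R)%:R <= c * 2 ^+ (9 * m k') * b'.
  by set z := _ * _%:R; set z' := _ * b'; lra.
have b'0 : 0 <= b' by exact: test_fun_ge0.
case: ltP => hw /=; last by rewrite mulr0; nonneg.
case: ltP => hd /=; last by rewrite mulr0; nonneg.
rewrite mulr1 -!mulrA ler_wpM2l //.
(* The upper end of the first interval is the middle of the second, as [test_fun_lb] requires. *)
have hb : 2 ^- (4 * m k') <= b'.
  apply: test_fun_lb => //; last by apply: le_trans rk; rewrite ler_pM2l // ltW.
  by rewrite subrK ltW.
apply: (@le_trans _ _ (2 ^+ (9 * m k') * 2 ^- (4 * m k'))); last first.
  by rewrite ler_wpM2l // exprn_ge0.
rewrite (_ : 9 * m k' = 5 * m k' + 4 * m k')%N; last by rewrite -mulnDl.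
rewrite exprD mulfK ?expf_neq0 // ler_eXn2l ?ltr1n //.
by rewrite -[10%N]/(5 * 2)%N -mulnA leq_mul2l mk.
Qed.

Lemma tail_error_ge0 ks d : 0 <= tail_error ks d.
Proof.
rewrite /tail_error sumr_ge0 // => k _.
by apply: mulr_ge0; [nonneg|exact: ler0n].
Qed.

(** If a point of the segment lies below [r k], so does one of the endpoints. *)
Lemma tail_error_segment ks (dx dy t : R) : 0 <= t -> t <= 1 ->
  tail_error ks (dx + t * (dy - dx)) <= tail_error ks dx + tail_error ks dy.
Proof.
move=> t0 t1; rewrite /tail_error -big_split /=; apply: ler_sum => k _.
rewrite -mulrDr ler_wpM2l //; first by nonneg.
rewrite -natrD ler_nat; case: (ltP (dx + _)) => h; last by [].
case: (ltP dx) => hx; first by [].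
case: (ltP dy) => hy; first by [].
exfalso; move: h; rewrite ltNge => /negP; apply.
rewrite (_ : _ + _ = (1 - t) * dx + t * dy); last by ring.
rewrite (_ : r k = (1 - t) * r k + t * r k); last by ring.
by apply: lerD; apply: ler_wpM2l; rewrite ?subr_ge0 //.
Qed.

(* The left-hand side is Psi 1 - Psi 0 for Psi = W' * profile (W, D), where W and D interpolate
   w and d along the edge, W with constant second derivative 2 c a and D linearly. *)
Lemma edge_ineq k ks T wx wy dx dy a :
  path scale_step k ks -> 3 / 4 <= T ->
  1 <= T + \sum_(j <- k :: ks) dl j / 2 ->
  wx <= 1 -> wy <= 1 -> 0 <= dx -> 0 <= dy -> (dy - dx) ^+ 2 <= a ->
  - (a * (tail_error (k :: ks) dx + tail_error (k :: ks) dy)) <=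
  (wy - wx + c * a) * profile T (k :: ks) wy dy -
  (wy - wx - c * a) * profile T (k :: ks) wx dx.
Proof.
move=> pk T0 T1 wx1 wy1 dx0 dy0 da.
have a0 : 0 <= a by apply: le_trans da; rewrite sqr_ge0.
have ca0 : 0 <= c * a by rewrite mulr_ge0.
set G := profile T (k :: ks); set err := _ + _.
pose W (t : R) := wx + (wy - wx - c * a) * t + c * a * t ^+ 2.
pose W' (t : R) := (wy - wx - c * a) + c * a * (2 * t).
pose D (t : R) := dx + (dy - dx) * t.
pose G' t := profile_dw T (k :: ks) (W t) (D t) * W' t +
  profile_dd T (k :: ks) (W t) (D t) * (dy - dx).
(* The linear term turns the claim into [f 0 <= f 1], so the mean value theorem only asks for a
   nonnegative derivative. *)
pose f t := W' t * G (W t) (D t) + a * err * t.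
pose f' t := W' t * G' t + G (W t) (D t) * (c * a * 2) + a * err.
have did (x : R) := is_derive_id x (1 : R).
have dcst (b x : R) := is_derive_cst b x (1 : R).
have dW (x : R) : is_derive x (1 : R) W (W' x).
  have h := is_derive_fctD (is_derive_fctD (dcst wx x)
    (is_derive_fctZ (wy - wx - c * a) (did x)))
    (is_derive_fctZ (c * a) (is_derive_fctX 2 (did x))).
  by apply: is_derive_eq; rewrite /W' /=; ring.
have dW' (x : R) : is_derive x (1 : R) W' (c * a * 2).
  have h := is_derive_fctD (dcst (wy - wx - c * a) x)
    (is_derive_fctZ (c * a) (is_derive_fctZ 2 (did x))).
  by apply: is_derive_eq; ring.
have dD (x : R) : is_derive x (1 : R) D (dy - dx).
  have h := is_derive_fctD (dcst dx x) (is_derive_fctZ (dy - dx) (did x)).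
  by apply: is_derive_eq; ring.
have df (x : R) : is_derive x (1 : R) f (f' x).
  have h := is_derive_fctD (is_derive_fctM (dW' x) (is_derive_profile T (k :: ks) (dW x) (dD x)))
    (is_derive_fctZ (a * err) (did x)).
  by apply: is_derive_eq; rewrite /f' /G' /G; ring.
have [t] : exists2 t, t \in `[0, 1]%R & f 1 - f 0 = f' t * (1 - 0).
  apply: MVT_segment => //.
  by apply: derivable_within_continuous => x _; have [] := df x.
rewrite in_itv /= => /andP[t0 t1]; rewrite subr0 mulr1.
have W1 : W 1 = wy by rewrite /W expr1n; ring.
have W0 : W 0 = wx by rewrite /W expr0n /=; ring.
have D1 : D 1 = dy by rewrite /D; ring.
have D0 : D 0 = dx by rewrite /D; ring.
rewrite /f W1 W0 D1 D0 /W' => hf.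
have ft : 0 <= f' t.
  have Wt : W t <= 1.
    have -> : W t = (1 - t) * wx + t * wy - c * a * (t * (1 - t)) by rewrite /W; ring.
    have h1 : (1 - t) * wx <= (1 - t) * 1 by rewrite ler_wpM2l // subr_ge0.
    have h2 : t * wy <= t * 1 by rewrite ler_wpM2l.
    have h3 : 0 <= c * a * (t * (1 - t)) by rewrite !mulr_ge0 // subr_ge0.
    lra.
  have Dt : 0 <= D t.
    have -> : D t = (1 - t) * dx + t * dy by rewrite /D; ring.
    by rewrite addr_ge0 // mulr_ge0 // subr_ge0.
  have := profile_ineq (W' t) pk T0 T1 Wt Dt da.
  rewrite -/(G _ _) => h.
  have h1 : tail_error (k :: ks) (D t) <= err.
    by rewrite /D mulrC; exact: tail_error_segment.
  have h2 : - (a * err) <=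
      a * (c * 2 ^+ (9 * m k) * test_fun (m k) (r k) (dl k) (T - dl k / 2) (W t) (D t) -
           tail_error (k :: ks) (D t)).
    have b0 : 0 <= c * 2 ^+ (9 * m k) * test_fun (m k) (r k) (dl k) (T - dl k / 2) (W t) (D t).
      by apply: mulr_ge0; [nonneg|exact: test_fun_ge0].
    rewrite -mulrN ler_wpM2l //; move: b0 h1; set b := _ * test_fun _ _ _ _ _ _.
    by move: (tail_error _ _) => te; clear; move: err b => e b; lra.
  have h3 := le_trans h2 h.
  have -> : f' t = 2 * c * a * G (W t) (D t) + W' t ^+ 2 * profile_dw T (k :: ks) (W t) (D t) +
      W' t * (dy - dx) * profile_dd T (k :: ks) (W t) (D t) + a * err.
    by rewrite /f' /G'; ring.
  by rewrite -lerBlDr sub0r.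
move: hf ft => <-; rewrite -/G; set u := G wx dx; set v := G wy dy => h.
rewrite -subr_ge0; apply: (le_trans h); rewrite le_eqVlt.
by apply/orP; left; apply/eqP; ring.
Qed.

End profile.

(** * Integration by parts over a finite set of vertices *)

Section nonexistence.
Variables (R : realType) (G : countType) (Gamma : weighted_graph R G).
Variables (alpha : G -> G -> R) (C : R) (w d : G -> R).
Hypothesis halpha : is_edge_weight Gamma alpha.
Hypothesis C_gt0 : 0 < C.
Hypothesis alphaC : forall x, \sum_(y \in nbrs Gamma x) weight Gamma x y * alpha x y <= C.
Hypothesis w_le1 : forall x, w x <= 1.
Hypothesis w_eq : forall x, generator Gamma w x = w x.
Hypothesis d_ge0 : forall x, 0 <= d x.
Hypothesis d_alpha : forall x y, adj Gamma x y -> (d y - d x) ^+ 2 <= alpha x y.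

Local Notation pi := (weight Gamma).

Definition nbr_seq x : seq G := finmap.enum_fset (fset_set (nbrs Gamma x)).

Lemma mem_nbr_seq x y : (y \in nbr_seq x) = adj Gamma x y.
Proof.
have fx : finite_set (nbrs Gamma x) by exact: (adj_locally_finite Gamma).
by rewrite /nbr_seq in_fset_set // /nbrs; apply/idP/idP; rewrite inE.
Qed.

Lemma weight0 x y : ~~ adj Gamma x y -> pi x y = 0.
Proof.
move=> h; apply/eqP; have := weight_ge0 Gamma x y.
by rewrite le_eqVlt weight_gt0 (negbTE h) orbF eq_sym.
Qed.

(** Weights vanish off the edges, so one list [S] can serve as range of summation for all vertices
    whose neighbours it contains. *)
Lemma sum_nbrs (F : G -> R) x (S : seq G) : uniq S ->
  (forall y, adj Gamma x y -> y \in S) ->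
  \sum_(y \in nbrs Gamma x) pi x y * F y = \sum_(y <- S) pi x y * F y.
Proof.
move=> uS hS; rewrite (fsbig_seq _ _ uS); apply: fsbig_widen => // y [_ /= /negP nxy].
by rewrite weight0 // mul0r.
Qed.

Lemma weight_alpha_ge0 x y : 0 <= pi x y * alpha x y.
Proof.
have [xy|xy] := boolP (adj Gamma x y); last by rewrite weight0 // mul0r.
by rewrite mulr_ge0 ?weight_ge0 // ltW // (edge_weight_gt0 halpha).
Qed.

Lemma sum_weight_alpha x (S : seq G) : uniq S ->
  \sum_(y <- S) pi x y * alpha x y <= C.
Proof.
move=> uS; apply: le_trans (alphaC x).
pose N := nbr_seq x.
have uS' : uniq (undup (S ++ N)) by exact: undup_uniq.
rewrite (sum_nbrs _ uS'); last first.
  move=> y xy; rewrite mem_undup mem_cat; apply/orP; right.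
  by rewrite /N mem_nbr_seq.
rewrite [leRHS](bigID (mem S)) /= -[X in _ <= X + _]big_filter.
rewrite [X in _ <= X + _](perm_big S) /=; last first.
  apply: uniq_perm => //; first exact: filter_uniq.
  by move=> y; rewrite mem_filter mem_undup mem_cat; case: (y \in S).
by rewrite lerDl sumr_ge0 // => y _; exact: weight_alpha_ge0.
Qed.

Variables (m : nat -> nat) (r dl : nat -> R).
Let c : R := (4 * C)^-1.
Hypothesis m_gt1 : forall k, (1 < m k)%N.
Hypothesis r_gt0 : forall k, 0 < r k.
Hypothesis dl_gt0 : forall k, 0 < dl k.
Hypothesis dl_le : forall k, dl k <= 1 / 2.
Hypothesis dl_r : forall k, 512 * (m k)%:R * dl k <= c * r k ^+ 2.
Hypothesis dl_m : forall k, 256 * (m k)%:R / (dl k * r k ^+ 2) <= c * 2 ^+ m k.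
Variable (B : nat -> seq G).
Hypothesis B_ball : forall k x, d x < r k -> x \in B k.
Hypothesis B_size : forall k, (size (B k) <= 2 ^ m k)%N.

(** As [m] at least doubles along the path, each term is at most half of the preceding one. *)
Lemma sum_scales k ks : path (scale_step m r) k ks ->
  \sum_(j <- k :: ks) 2 ^- (5 * m j) <= 2 * 2 ^- (5 * m k) :> R.
Proof.
elim: ks k => [|k' ks IH] k /=.
  by rewrite big_seq1 ler_peMl ?ler1n // invr_ge0 exprn_ge0.
move=> /andP[/andP[mk _] /IH h]; rewrite big_cons.
have : 2 * 2 ^- (5 * m k') <= 2 ^- (5 * m k) :> R.
  rewrite (_ : 2 * _ = 2 ^- (5 * m k').-1); last first.
    have -> : (5 * m k' = (5 * m k').-1.+1)%N.
      by rewrite prednK // muln_gt0 /= ltnW.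
    by rewrite /= exprS; field; rewrite expf_neq0.
  rewrite lef_pV2 ?posrE ?exprn_gt0 // ler_eXn2l ?ltr1n //.
  by have := m_gt1 k; move: mk; move: (m k) (m k') => a b; lia.
move: h; move: (2 ^- (5 * m k)) (2 ^- (5 * m k') : R) (\sum_(_ <- _) _) => a b e.
by lra.
Qed.

(** The sum of [E] over S x S is computed twice. Edge by edge it exceeds -1/4, by [edge_ineq] and
    the sizes of the balls; vertex by vertex it is at most -1/4, by the equation for [w]. *)
Lemma no_solution k ks x0 : path (scale_step m r) k ks ->
  1 <= 3 / 4 + \sum_(j <- k :: ks) dl j / 2 ->
  3 / 4 <= w x0 -> 16 * d x0 <= r k -> False.
Proof.
move=> pk T1 wx0 dx0.
have c0 : 0 < c by rewrite invr_gt0 mulr_gt0.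
have c0' := ltW c0.
have T0 : 3 / 4 <= 3 / 4 :> R by [].
pose K := k :: ks.
pose g x := profile m r dl (3 / 4) K (w x) (d x).
pose te x := tail_error c m r K (d x).
pose bs := flatten [seq B j | j <- K].
pose N := nbr_seq.
(* [bs] contains the support of [g]; with the neighbours added, summing over [S] gives the full
   generator at each point of the support. *)
pose S := undup (bs ++ flatten [seq N x | x <- bs]).
have uS : uniq S by exact: undup_uniq.
have g0 x : 0 <= g x by exact: profile_ge0.
have te0 x : 0 <= te x by exact: tail_error_ge0.
have memN x y : adj Gamma x y -> y \in N x.
  by move=> xy; rewrite /N mem_nbr_seq.
have membs j x : j \in K -> d x < r j -> x \in bs.
  move=> jK dj; apply/flattenP; exists (B j); last exact: B_ball.
  exact: map_f.
have gN x : g x != 0 -> 1 / 2 < w x /\ x \in bs.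
  move=> gx; split.
    rewrite ltNge; apply/negP => h; move/eqP: gx; apply.
    by apply: profile_eq0 => //; left.
  apply/negPn/negP => h; move/eqP: gx; apply.
  apply: profile_eq0 => //; right => j jK; rewrite leNgt; apply/negP => dj.
  by move/negP: h; apply; exact: membs dj.
(* Boundary term at x of the integration by parts along the edge: minus the outgoing derivative of
   the interpolation, times [g x]. *)
pose E x y := pi x y * (w x - w y + c * alpha x y) * g x.
pose F x y := pi x y * alpha x y * te x.
have EF x y : - (F x y + F y x) <= E x y + E y x.
  rewrite /E /F (weight_sym Gamma y x).
  have [xy|xy] := boolP (adj Gamma x y); last by rewrite weight0 // !mul0r addr0 oppr0.
  rewrite -(edge_weight_sym halpha xy).
  have h := edge_ineq c0' m_gt1 r_gt0 dl_gt0 dl_le dl_r dl_m pk T0 T1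
    (w_le1 x) (w_le1 y) (d_ge0 x) (d_ge0 y) (d_alpha xy).
  have {h} := ler_wpM2l (weight_ge0 Gamma x y) h.
  rewrite -/(g x) -/(g y) -/(te x) -/(te y) => h.
  rewrite (_ : - (_ + _) = pi x y * - (alpha x y * (te x + te y))); last by ring.
  by apply: (le_trans h); rewrite le_eqVlt; apply/orP; left; apply/eqP; ring.
have sumEF : - (\sum_(x <- S) \sum_(y <- S) F x y) <= \sum_(x <- S) \sum_(y <- S) E x y.
  have : \sum_(x <- S) \sum_(y <- S) - (F x y + F y x) <=
         \sum_(x <- S) \sum_(y <- S) (E x y + E y x).
    by apply: ler_sum => x _; apply: ler_sum => y _.
  under eq_bigr do rewrite sumrN big_split /=.
  rewrite sumrN big_split /= [X in - (_ + X)]exchange_big /=.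
  under [X in _ <= X]eq_bigr do rewrite big_split /=.
  rewrite big_split /= [X in _ <= _ + X]exchange_big /=.
  by move: (\sum_(x <- S) \sum_(y <- S) F x y) (\sum_(x <- S) \sum_(y <- S) E x y)
    => a b; lra.
(* The choice [c = 1 / (4 C)] keeps the bending at most 1/4, against [w x > 1/2] on the support of
   [g]. *)
have hE x : \sum_(y <- S) E x y <= - (g x / 4).
  rewrite /E -mulr_suml.
  have [->|gx] := eqVneq (g x) 0; first by rewrite mulr0 mul0r oppr0.
  have [w2 xbs] := gN x gx.
  rewrite -mulrN mulrC ler_wpM2l //.
  have nS y : adj Gamma x y -> y \in S.
    move=> xy; rewrite mem_undup mem_cat; apply/orP; right.
    by apply/flattenP; exists (N x); [exact: map_f|exact: memN].
  have hL : \sum_(y <- S) pi x y * (w y - w x) = w x.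
    by rewrite -sum_nbrs // -/(generator Gamma w x) w_eq.
  under eq_bigr do rewrite mulrDr -opprB mulrN mulrCA.
  rewrite big_split /= sumrN hL -mulr_sumr.
  have : c * (\sum_(y <- S) pi x y * alpha x y) <= c * C.
    by rewrite ler_wpM2l // sum_weight_alpha.
  have -> : c * C = 1 / 4 by rewrite /c; field; rewrite gt_eqF.
  by move: w2; move: (w x) (c * _) => a b; lra.
have hF x : \sum_(y <- S) F x y <= C * te x.
  by rewrite /F -mulr_suml ler_wpM2r // sum_weight_alpha.
(* At most [2 ^ m j] vertices meet the j-th term, which lowers its exponent from 6 to 5. *)
have hte : \sum_(x <- S) te x <= c * \sum_(j <- K) 2 ^- (5 * m j).
  rewrite /te /tail_error exchange_big /= mulr_sumr; apply: ler_sum => j _.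
  rewrite -mulr_sumr -mulrA ler_wpM2l //.
  rewrite -natr_sum -big_mkcond /= sum1_count.
  have : (count (fun x => d x < r j)%R S <= 2 ^ m j)%N.
    apply: leq_trans (B_size j); rewrite -size_filter; apply: uniq_leq_size.
      exact: filter_uniq.
    by move=> x; rewrite mem_filter => /andP[dx _]; exact: B_ball.
  rewrite -(ler_nat R) natrX => h.
  rewrite (_ : 6 * m j = 5 * m j + m j)%N; last by rewrite -mulSnr.
  rewrite exprD invfM -mulrA ler_piMr ?invr_ge0 ?exprn_ge0 //.
  by rewrite mulrC ler_pdivrMr ?exprn_gt0 // mul1r.
have x0S : x0 \in S.
  rewrite mem_undup mem_cat (membs k) ?mem_head //.
  have := d_ge0 x0; have := r_gt0 k; move: dx0; move: (d x0) (r k) => a b; lra.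
have gx0 : 1 <= g x0.
  rewrite /g /profile /K /=; apply: ler_wpDr.
    by rewrite -[X in 0 <= X]/(profile m r dl _ ks _ _) profile_ge0.
  have hb : 2 ^- (4 * m k) <= test_fun (m k) (r k) (dl k) (3 / 4 - dl k / 2) (w x0) (d x0).
    by apply: test_fun_lb => //; rewrite subrK.
  apply: (@le_trans _ _ (2 ^+ (9 * m k) * 2 ^- (4 * m k))); last first.
    by rewrite ler_wpM2l // exprn_ge0.
  rewrite (_ : 9 * m k = 5 * m k + 4 * m k)%N; last by rewrite -mulnDl.
  by rewrite exprD mulfK ?expf_neq0 // exprn_ege1 // ler1n.
have sumg : 1 <= \sum_(x <- S) g x.
  apply: (le_trans gx0); rewrite (big_rem x0) //= lerDl sumr_ge0 //.
have h1 : \sum_(x <- S) \sum_(y <- S) E x y <= - (\sum_(x <- S) g x) / 4.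
  rewrite mulNr mulr_suml -sumrN; exact: ler_sum.
have h2 : \sum_(x <- S) \sum_(y <- S) F x y <= C * \sum_(x <- S) te x.
  by rewrite mulr_sumr; exact: ler_sum.
have h3 : C * (\sum_(x <- S) te x) <= C * (c * \sum_(j <- K) 2 ^- (5 * m j)).
  by rewrite ler_wpM2l // ltW.
have h4 : C * (c * \sum_(j <- K) 2 ^- (5 * m j)) = 1 / 4 * \sum_(j <- K) 2 ^- (5 * m j).
  by rewrite /c; field; rewrite gt_eqF.
have h5 := sum_scales pk.
have h6 : 2 * 2 ^- (5 * m k) < 1 :> R.
  rewrite ltr_pdivrMr ?exprn_gt0 // mul1r -[X in X < _]expr1 ltr_eXn2l ?ltr1n //.
  by rewrite (leq_trans (m_gt1 k)) // leq_pmull.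
have : - (1 / 4) < \sum_(x <- S) \sum_(y <- S) E x y.
  apply: lt_le_trans sumEF; rewrite ltrN2; apply: (le_lt_trans h2).
  apply: (le_lt_trans h3); rewrite h4 gtr_pMr ?divr_gt0 //.
  exact: le_lt_trans h6.
move=> /lt_le_trans /(_ h1); rewrite mulNr ltrN2 ltr_pM2r ?invr_gt0 // ltNge.
by rewrite sumg.
Qed.

End nonexistence.

(** * Choice of the scales, and uniqueness for L v = v *)

Lemma sqr_le_exp2 (R : realType) (A : R) :
  exists n0 : nat, forall n, (n0 <= n)%N -> A * n%:R ^+ 2 <= 2 ^+ n.
Proof.
(* The induction starts from 1000 <= 1024; then A n^2 <= n^3 <= 2^n as soon as n >= A and n >=
   10. *)
have cube n : ((n + 10) ^ 3 <= 2 ^ (n + 10))%N.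
  elim: n => [//|n IH]; rewrite addSn [X in (_ <= X)%N]expnS.
  by move: (2 ^ _)%N IH => z; rewrite !expnS expn0 !muln1; nia.
exists (maxn 10 (Num.truncn (Num.max A 0)).+1) => n; rewrite geq_max => /andP[n10 nA].
have An : A <= n%:R.
  apply: (@le_trans _ _ (Num.max A 0)); first by rewrite le_max lexx.
  have A0 : 0 <= Num.max A 0 by rewrite le_max lexx orbT.
  apply: ltW; apply: lt_le_trans (truncnS_gt _) _.
  by rewrite ler_nat.
apply: (@le_trans _ _ (n%:R * n%:R ^+ 2)); first by rewrite ler_wpM2r ?exprn_ge0.
have := cube (n - 10)%N; rewrite subnK // -(ler_nat R) !natrX.
by rewrite exprS.
Qed.

Lemma ler_sum_ord (R : numDomainType) (F : nat -> R) (n n' : nat) :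
  (forall k, 0 <= F k) -> (n <= n')%N -> \sum_(k < n) F k <= \sum_(k < n') F k.
Proof.
move=> F0 nn'; rewrite -!(big_mkord xpredT F) (big_cat_nat (leq0n n) nn') /= lerDl.
exact: sumr_ge0.
Qed.

(** Either one truncated term already equals [b], or no term is truncated. *)
Lemma sum_min_ge (R : realType) (e : nat -> R) (b : R) (ks : seq nat) :
  (forall k, 0 <= e k) -> 0 <= b ->
  b <= \sum_(k <- ks) e k -> b <= \sum_(k <- ks) Num.min (e k) b.
Proof.
move=> e0 b0; have [/hasP[j jks bj] _|/hasPn h] := boolP (has (fun k => b <= e k) ks).
  rewrite (big_rem j) //= (min_r bj) lerDl sumr_ge0 // => i _.
  by rewrite le_min e0.
move=> hb; rewrite big_seq (eq_bigr e) -?big_seq // => k kks.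
by rewrite min_l // ltW // ltNge h.
Qed.

(* Scales k with m (k + 1) < 2 * m k are dropped: there e doubles from k to k + 1, so that the
   dropped terms form geometric runs dominated by the next selected term. *)
Lemma select_scales (R : realType) (m : nat -> nat) (r e : nat -> R) :
  {homo m : i j / (i <= j)%N} ->
  (forall k, 0 <= r k) -> (forall k, 16 * r k <= r k.+1) -> (forall k, 0 <= e k) ->
  (forall k, (m k.+1 < 2 * m k)%N -> 2 * e k <= e k.+1) ->
  forall n k, exists k' ks, [/\ (k <= k')%N, path (scale_step m r) k' ks &
    e k + \sum_(j < n.+1) e (k + j)%N <= 2 * \sum_(j <- k' :: ks) e j].
Proof.
move=> mm r0 rr e0 me; have rm : {homo r : i j / (i <= j)%N >-> i <= j}.
  apply: homo_leq => // [|k]; first exact: le_trans.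
  by apply: le_trans (rr k); rewrite ler_peMl // ler1n.
elim=> [|n IH] k.
  by exists k, [::]; split=> //; rewrite big_ord1 big_seq1 addn0; lra.
have [k' [ks [kk' pk hk]]] := IH k.+1.
rewrite big_ord_recl addn0 (eq_bigr (fun j : 'I_n.+1 => e (k.+1 + j)%N)); last first.
  by move=> j _; rewrite addSnnS.
have [h|h] := leqP (2 * m k) (m k.+1).
- exists k, (k' :: ks); split=> //=.
    rewrite pk andbT /scale_step (leq_trans h (mm _ _ kk')) /=.
    exact: le_trans (rr k) (rm _ _ kk').
  rewrite big_cons mulrDr; have := e0 k.+1; lra.
(* With [k] dropped, [e k] occurs twice on the left and [e k.+1] covers both; the isolated [e k] in
   the statement serves this step. *)
- exists k', ks; split=> //; first exact: ltnW.
  have := me _ h; lra.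
Qed.

Section uniqueness.
Variables (R : realType) (G : countType) (Gamma : weighted_graph R G).
Variables (alpha : G -> G -> R) (C : R) (d : G -> R).
Hypothesis halpha : is_edge_weight Gamma alpha.
Hypothesis C_gt0 : 0 < C.
Hypothesis alphaC : forall x, \sum_(y \in nbrs Gamma x) weight Gamma x y * alpha x y <= C.
Hypothesis d_ge0 : forall x, 0 <= d x.
Hypothesis d_alpha : forall x y, adj Gamma x y -> (d y - d x) ^+ 2 <= alpha x y.
Variables (m : nat -> nat) (B : nat -> seq G).
Hypothesis m_gt : forall k, (k < m k)%N.
Hypothesis m_homo : {homo m : i j / (i <= j)%N}.
Hypothesis B_ball : forall k x, d x <= 16 ^+ k -> x \in B k.
Hypothesis B_size : forall k, (size (B k) <= 2 ^ m k)%N.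
Hypothesis diverges : forall A : R, exists n, A <= \sum_(k < n) 256 ^+ k / (m k)%:R.

Lemma normalized_solution_false (w : G -> R) x1 : (forall x, w x <= 1) ->
  (forall x, generator Gamma w x = w x) -> 3 / 4 <= w x1 -> False.
Proof.
move=> w1 hw wx1.
pose c : R := (4 * C)^-1.
have c0 : 0 < c by rewrite invr_gt0 mulr_gt0.
have p512 : 0 < 512 :> R by rewrite ltr0n.
have p512' := ltW p512.
have p256 : 0 < 256 :> R by rewrite ltr0n.
have [n1 hn1] := sqr_le_exp2 (2 ^+ 17 / c ^+ 2).
have [n2 hn2] := sqr_le_exp2 (512 / c).
pose n3 := (Num.truncn (16 * d x1)).+1.
(* From scale [k0] on, [2 ^+ M k] beats the polynomial terms of [dlm] ([n1], [n2]), [x1] satisfies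
   [16 * d x1 <= r k] ([n3]), and [M k > 1]. *)
pose k0 := (n1 + n2 + n3 + 1)%N.
pose M k := m (k0 + k)%N.
pose r k : R := 16 ^+ (k0 + k).
(* The largest width that [dlr] permits. As [r k ^+ 2] is 256^(k0 + k), these widths sum to c / 512
   times a tail of the divergent series. *)
pose e k : R := c * r k ^+ 2 / (512 * (M k)%:R).
pose dl k := Num.min (e k) (1 / 2).
have Mk k : (k0 + k < M k)%N by exact: m_gt.
have M0 k : 0 < (M k)%:R :> R by rewrite ltr0n (leq_trans _ (Mk k)).
have M1 k : (1 < M k)%N by apply: leq_ltn_trans (Mk k); rewrite /k0; lia.
have r0 k : 0 < r k by rewrite exprn_gt0.
have r1 k : 1 <= r k by rewrite exprn_ege1 // ler1n.
have r21 k : 1 <= r k ^+ 2 by rewrite exprn_ege1.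
have e0 k : 0 < e k by rewrite divr_gt0 ?mulr_gt0 ?exprn_gt0.
have dl0 k : 0 < dl k by rewrite lt_min e0 divr_gt0.
have dl2 k : dl k <= 1 / 2 by rewrite ge_min lexx orbT.
have dlr k : 512 * (M k)%:R * dl k <= c * r k ^+ 2.
  have : dl k <= e k by rewrite ge_min lexx.
  by rewrite /e ler_pdivlMr ?mulr_gt0 // mulrC.
(* [n1] serves the case [dl k = e k], where 2^17 = 256 * 512 appears, and [n2] the case
   [dl k = 1/2]. *)
have dlm k : 256 * (M k)%:R / (dl k * r k ^+ 2) <= c * 2 ^+ M k.
  rewrite ler_pdivrMr ?mulr_gt0 ?exprn_gt0 //.
  have n1M : (n1 <= M k)%N by have := Mk k; rewrite /k0; lia.
  have n2M : (n2 <= M k)%N by have := Mk k; rewrite /k0; lia.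
  have h1 : 2 ^+ 17 * (M k)%:R ^+ 2 <= c ^+ 2 * 2 ^+ M k.
    have := hn1 _ n1M; rewrite mulrAC ler_pdivrMr ?exprn_gt0 //.
    by rewrite [X in _ <= X]mulrC.
  have h2 : 512 * (M k)%:R ^+ 2 <= c * 2 ^+ M k.
    have := hn2 _ n2M; rewrite mulrAC ler_pdivrMr //.
    by rewrite [X in _ <= X]mulrC.
  have Mn1 : 1 <= (M k)%:R :> R by rewrite ler1n ltnW.
  rewrite /dl; case: (leP (e k) (1 / 2)) => _.
    rewrite /e.
    have -> : c * 2 ^+ M k * (c * r k ^+ 2 / (512 * (M k)%:R) * r k ^+ 2) =
       (c ^+ 2 * 2 ^+ M k) * (r k ^+ 2 * r k ^+ 2) / (512 * (M k)%:R).
      by field; rewrite gt_eqF.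
    rewrite ler_pdivlMr ?mulr_gt0 //.
    have -> : 256 * (M k)%:R * (512 * (M k)%:R) = 2 ^+ 17 * (M k)%:R ^+ 2 :> R by ring.
    apply: (le_trans h1); apply: ler_peMr; first by nonneg.
    by rewrite mulr_ege1.
  have h3 : 512 * (M k)%:R <= 512 * (M k)%:R ^+ 2 :> R.
    by rewrite ler_pM2l // expr2 ler_peMl // ltW.
  have h4 : c * 2 ^+ M k <= c * 2 ^+ M k * r k ^+ 2.
    by apply: ler_peMr => //; nonneg.
  have := le_trans (le_trans h3 h2) h4.
  by rewrite mulrCA; move: (_ * _ * _) => z; lra.
have Me k : (M k.+1 < 2 * M k)%N -> 2 * e k <= e k.+1.
  move=> h; have {}h : (M k.+1)%:R <= 2 * (M k)%:R :> R.
    by rewrite -natrM ler_nat ltnW.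
  have rk : r k.+1 ^+ 2 = 256 * r k ^+ 2 
    by rewrite (_ : r k.+1 = 16 * r k); [ring|rewrite /r addnS exprS].
  rewrite /e rk mulrA ler_pdivlMr ?mulr_gt0 // mulrAC ler_pdivrMr ?mulr_gt0 //.
  have p0 : 0 <= c * r k ^+ 2 by nonneg.
  have := ler_wpM2l p0 h.
  have : 0 <= c * r k ^+ 2 * (M k)%:R by apply: mulr_ge0.
  by rewrite !mulrA; lra.
have [n hn] := diverges (\sum_(k < k0) 256 ^+ k / (m k)%:R + 512 / c).
have hS : 1 <= \sum_(j < n.+1) e (0 + j)%N.
  have kn : (k0 <= n)%N.
    rewrite leqNgt; apply/negP => nk.
    have : \sum_(k < n) 256 ^+ k / (m k)%:R <= \sum_(k < k0) 256 ^+ k / (m k)%:R :> R.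
      apply: (@ler_sum_ord _ (fun k => 256 ^+ k / (m k)%:R)); last exact: ltnW.
      by move=> k; rewrite divr_ge0 ?exprn_ge0 ?ler0n // ltW.
    have : 0 < 512 / c by rewrite divr_gt0.
    by move: hn; lra.
  have split_sum (F : nat -> R) :
      \sum_(k < n) F k = \sum_(k < k0) F k + \sum_(j < n - k0) F (k0 + j)%N.
    by rewrite -[in LHS](subnKC kn) big_split_ord.
  move: hn; rewrite (split_sum (fun k => 256 ^+ k / (m k)%:R)) lerD2l => hn.
  have h3 : 512 / c <= 512 / c * \sum_(j < n - k0) e j.
    apply: (le_trans hn); rewrite mulr_sumr; apply: ler_sum => i _.
    rewrite /e /r -exprM mulnC exprM.
    rewrite (_ : 16 ^+ 2 = 256 :> R); last by ring.
    by rewrite /M le_eqVlt; apply/orP; left; apply/eqP; field; rewrite !gt_eqF // M0.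
  rewrite ler_pMr ?divr_gt0 // in h3; apply: (le_trans h3).
  apply: ler_sum_ord; first by move=> j; exact: ltW.
  by rewrite ltnW // ltnS leq_subr.
have Mm : {homo M : i j / (i <= j)%N} by move=> i j ij; apply: m_homo; rewrite leq_add2l.
have rr k : 16 * r k <= r k.+1 by rewrite /r addnS exprS.
have [k [ks [_ pk hk]]] := select_scales Mm (fun k => ltW (r0 k)) rr (fun k => ltW (e0 k)) Me n 0.
have T1 : 1 <= 3 / 4 + \sum_(j <- k :: ks) dl j / 2.
  have : 1 / 2 <= \sum_(j <- k :: ks) dl j.
    apply: sum_min_ge => // [j|]; first exact: ltW.
    by have := e0 0%N; move: hk hS; lra.
  by rewrite -mulr_suml; lra.
apply: (@no_solution _ _ _ _ _ _ _ halpha C_gt0 alphaC w1 hw d_ge0 d_alpha M r dl M1 r0 dl0 dl2 dlr dlm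
  (fun k => B (k0 + k)%N) _ _ k ks x1 pk T1 wx1).
- by move=> j x dx; apply: B_ball; exact: ltW.
- by move=> j; exact: B_size.
have n3r : (n3 <= 16 ^ (k0 + k))%N.
  apply: (@leq_trans (16 ^ n3)); first by rewrite ltnW // ltn_expl.
  rewrite leq_exp2l // (leq_trans _ (leq_addr _ _)) // /k0 addn1 (leq_trans _ (leqnSn _)) //.
  exact: leq_addl.
have : (n3%:R : R) <= r k by rewrite /r -natrX ler_nat.
apply: le_trans; apply: ltW; exact: truncnS_gt.
Qed.

Lemma bounded_solution_eq0 (v : G -> R) : (forall x, 0 <= v x <= 1) ->
  (forall x, generator Gamma v x = v x) -> forall x, v x = 0.
Proof.
move=> v01 hv x; apply/eqP; rewrite eq_le (andP (v01 x)).1 andbT leNgt; apply/negP => vx.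
pose V := range v.
have hV : has_sup V.
  split; first by exists (v x); exists x.
  by exists 1 => _ [y _ <-]; case/andP: (v01 y).
pose s := sup V.
have vs y : v y <= s by apply: ub_le_sup; [exact: hV.2|exists y].
have s0 : 0 < s by exact: lt_le_trans (vs x).
have s4 : 0 < s / 4 by rewrite divr_gt0.
have [_ [x1 _ <-] hx1] := sup_adherent s4 hV.
apply: (@normalized_solution_false (fun y => v y / s) x1).
- by move=> y; rewrite ler_pdivrMr // mul1r.
- move=> y; rewrite -[in RHS]hv /generator [RHS]mulrC mulr_fsumr.
  by apply: eq_fsbigr => z _; ring.
- by rewrite ler_pdivlMr //; apply: ltW; move: hx1; rewrite -/s; lra.
Qed.

End uniqueness.

(** * Bounding an integral by covering its domain *)

Section covering_integral.
Variable R : realType.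
Local Notation mu := (@lebesgue_measure R).

(** The integral of a nonnegative function is a supremum over the simple functions below it, hence
    monotone for arbitrary functions; this lets [volume_quotient] be bounded directly. *)
Lemma ge0_le_integral_nonmeasurable (D : set R) (f1 f2 : R -> \bar R) :
  (forall x, D x -> (0 <= f1 x <= f2 x)%E) ->
  (\int[mu]_(x in D) f1 x <= \int[mu]_(x in D) f2 x)%E.
Proof.
move=> f12; rewrite !ge0_integralE; first last.
- by move=> x /f12 /andP[].
- by move=> x /f12 /andP[]; exact: le_trans.
apply: le_ereal_sup => _ [h /= hf <-]; exists h => //= x.
apply: (le_trans (hf x)); rewrite /patch; case: ifPn => // /set_mem Dx.
by have /andP[] := f12 _ Dx.
Qed.

(** The intervals may overlap: f is below the sum of all the step functions, which is integrated
    term by term. *)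
Lemma integral_le_cover (D : set R) (f : R -> \bar R) (c a b : nat -> R) (A : R) :
  measurable D -> (forall k, 0 <= c k) -> (forall k, a k <= b k) ->
  (forall n, \sum_(k < n) c k * (b k - a k) <= A) ->
  (forall x, D x -> (0 <= f x)%E) ->
  (forall x, D x -> exists k, a k <= x <= b k /\ (f x <= (c k)%:E)%E) ->
  (\int[mu]_(x in D) f x <= A%:E)%E.
Proof.
move=> mD c0 ab hA f0 hf.
pose g k x : \bar R := (c k * \1_(`[a k, b k]%classic) x)%:E.
have g0 k x : (0 <= g k x)%E by rewrite lee_fin mulr_ge0.
have mg k : measurable_fun D (g k).
  apply/measurable_EFinP; apply: measurable_funM; first exact: measurable_cst.
  by apply: measurable_indic; exact: measurable_itv.
apply: (@le_trans _ _ (\int[mu]_(x in D) (\sum_(k <oo) g k x))%E).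
  apply: ge0_le_integral_nonmeasurable => x Dx; rewrite f0 //=.
  have [k [xk fk]] := hf x Dx; apply: (le_trans fk).
  apply: le_trans (@nneseries_lim_ge _ (g^~ x) xpredT 0 k.+1 _) => //.
  rewrite big_nat_recr //= -[X in (X <= _)%E]add0e leeD ?sume_ge0 //.
  by rewrite /g indicE mem_set ?mulr1 //= in_itv /=.
rewrite integral_nneseries //.
apply: lime_le; first by apply: is_cvg_nneseries => n _ _; exact: integral_ge0.
near=> n; apply: (@le_trans _ _ (\sum_(k < n) c k * (b k - a k))%:E); last first.
  by rewrite lee_fin.
rewrite big_mkord -sumEFin; apply: lee_sum => k _.
under eq_integral do rewrite /g EFinM.
rewrite ge0_integralZl //; last by rewrite lee_fin.
  rewrite integral_indic // EFinM lee_wpmul2l ?lee_fin //.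
  apply: (@le_trans _ _ (mu `[a k, b k]%classic)).
    by apply: le_measure; rewrite ?inE //; first exact: measurableI.
  rewrite lebesgue_measure_itv /=; case: ifP => //.
  by move=> _; rewrite lee_fin subr_ge0.
by apply/measurable_EFinP; apply: measurable_indic; exact: measurable_itv.
Unshelve. all: by end_near. Qed.

End covering_integral.

(** Here f is [up_log 2 N], for which only 2^(f - 1) < N is known; the 4 pays for the shift to
    [f.-1]. *)
Lemma half_log_bound (f k : nat) :
  (2 * k + 4 <= f + k + 1)%N -> (f + k + 1 <= 2 * f.-1)%N.
Proof. lia. Qed.

(** * Volume growth: from the integral to a series over the radii 16^k *)

Section volume.
Variables (R : realType) (G : countType) (rho : G -> G -> R) (x0 : G) (r0 : R).
Hypothesis hrho : is_metric rho.
Hypothesis r0_gt0 : 0 < r0.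
Local Notation mu := (@lebesgue_measure R).
Hypothesis hint :
  (\int[mu]_(r in `[r0, +oo[) volume_quotient rho x0 r = +oo)%E.

Local Notation vq := (volume_quotient rho x0).

Definition ball_seq (r : R) : seq G := finmap.enum_fset (fset_set (mball rho x0 r)).

Lemma mem_ball_seq r x : finite_set (mball rho x0 r) -> (x \in ball_seq r) = (rho x0 x <= r).
Proof.
by move=> fb; rewrite /ball_seq in_fset_set // /mball; apply/idP/idP; rewrite inE.
Qed.

Lemma uniq_ball_seq r : uniq (ball_seq r).
Proof. exact: finmap.fset_uniq. Qed.

Lemma volume_quotient_infinite r : ~ finite_set (mball rho x0 r) -> vq r = 0%E.
Proof.
move=> fb; rewrite /volume_quotient /counting; case: asboolP => // _.
by rewrite /lne /= invey mule0.
Qed.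

(** One formula covers all finite balls: real division by 0 gives 0, the convention of
    [volume_quotient] for a one-point ball. *)
Lemma volume_quotient_finite r : 0 < r -> finite_set (mball rho x0 r) ->
  vq r = (r / ln (size (ball_seq r))%:R)%:E.
Proof.
move=> r_gt0 fb; rewrite /volume_quotient /counting; case: asboolP => // _.
rewrite -/(ball_seq r).
have N0 : (0 < size (ball_seq r))%N.
  rewrite -has_predT; apply/hasP; exists x0 => //.
  by rewrite mem_ball_seq // (metric_eq0 hrho x0 x0).2 // ltW.
rewrite lne_EFin ?ltr0n // eqe; case: eqVneq => [->|l0]; first by rewrite invr0 mulr0.
by rewrite inver (negbTE l0).
Qed.

Lemma volume_quotient_ge0 r : 0 < r -> (0 <= vq r)%E.
Proof.
move=> r_gt0; have [fb|fb] := pselect (finite_set (mball rho x0 r)); last first.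
  by rewrite volume_quotient_infinite.
rewrite volume_quotient_finite // lee_fin divr_ge0 ?(ltW r_gt0) //.
have [->|n0] := eqVneq (size (ball_seq r)) 0%N; first by rewrite ln0.
by rewrite ln_ge0 // ler1n lt0n.
Qed.

Lemma volume_quotient_le r (b : R) : 0 < r -> 0 < b ->
  (finite_set (mball rho x0 r) -> (1 < size (ball_seq r))%N ->
    b <= ln (size (ball_seq r))%:R) ->
  (vq r <= (r / b)%:E)%E.
Proof.
move=> r_gt0 b0 hb.
have rb : 0 <= r / b by apply: divr_ge0; exact: ltW.
have [fb|fb] := pselect (finite_set (mball rho x0 r)); last first.
  by rewrite volume_quotient_infinite.
rewrite volume_quotient_finite //; have [h|h] := leqP (size (ball_seq r)) 1.
  have -> : ln (size (ball_seq r))%:R = 0 :> R.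
    by move: h; case: (size _) => [|[|]] // _; rewrite ?ln1 // ln0.
  by rewrite invr0 mulr0 lee_fin.
by rewrite lee_fin ler_pM2l // lef_pV2 ?posrE ?hb // (lt_le_trans b0) ?hb.
Qed.

Lemma ln2_gt0 : 0 < ln 2 :> R.
Proof. by rewrite ln_gt0 // ltr1n. Qed.

Lemma volume_quotient_le_ln2 r : 0 < r -> (vq r <= (r / ln 2)%:E)%E.
Proof.
move=> r_gt0; apply: volume_quotient_le ln2_gt0 _ => // _ h.
by rewrite ler_ln ?posrE ?ltr0n ?ler_nat // ltnW.
Qed.

Lemma mball_subset r s : r <= s -> mball rho x0 r `<=` mball rho x0 s.
Proof. by move=> rs x; rewrite /mball /= => /le_trans; apply. Qed.

(** If this ball were infinite, the quotient would vanish from radius r on; below r it is at most x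
    / ln 2, so the integral would be finite. *)
Lemma finite_mball r : finite_set (mball rho x0 r).
Proof.
apply: contrapT => nfb.
pose K := Num.max r 0 / ln 2.
have K0 : 0 <= K by rewrite divr_ge0 ?(ltW ln2_gt0) // le_max lexx orbT.
have l2 := ln2_gt0.
suff : (\int[mu]_(r in `[r0, +oo[) vq r <= ((K + 1) * Num.max r 0)%:E)%E.
  by rewrite hint leye_eq.
pose a k : R := if k is 0%N then 0 else Num.max r 0 + (k.-1)%:R.
pose b k : R := if k is 0%N then Num.max r 0 else Num.max r 0 + k%:R.
apply: (@integral_le_cover _ _ _ (fun k => if k is 0%N then K else 0) a b) => //.
- by case.
- case=> [|k] /=; first by rewrite le_max lexx orbT.
  by rewrite lerD2l ler_nat.
- have m0 : 0 <= Num.max r 0 by rewrite le_max lexx orbT.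
  case=> [|n]; first by rewrite big_ord0 mulr_ge0 // addr_ge0.
  rewrite big_ord_recl /= subr0 big1 ?addr0 => [|i _]; last by rewrite mul0r.
  by rewrite ler_wpM2r // lerDl.
- move=> x /=; rewrite in_itv /= andbT => r0x.
  exact: volume_quotient_ge0 (lt_le_trans r0_gt0 r0x).
move=> x /=; rewrite in_itv /= andbT => r0x; have x_gt0 := lt_le_trans r0_gt0 r0x.
have [xr|rx] := leP x (Num.max r 0).
  exists 0%N => /=; split; first by rewrite (ltW x_gt0).
  apply: (le_trans (volume_quotient_le_ln2 x_gt0)).
  by rewrite lee_fin ler_pM2r ?invr_gt0.
have rx' : r <= x by apply: ltW; apply: le_lt_trans rx; rewrite le_max lexx.
exists (Num.truncn (x - Num.max r 0)).+1 => /=; split; last first.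
  by rewrite volume_quotient_infinite // => /(sub_finite_set (mball_subset rx')).
have /truncn_itv/andP[h1 h2] : 0 <= x - Num.max r 0 by rewrite subr_ge0 ltW.
by rewrite -lerBrDl h1 /= -lerBlDl ltW.
Qed.

Lemma mem_ball_seqE r x : (x \in ball_seq r) = (rho x0 x <= r).
Proof. exact: mem_ball_seq (finite_mball r). Qed.

Lemma size_ball_seq r s : r <= s -> (size (ball_seq r) <= size (ball_seq s))%N.
Proof.
move=> rs; apply: uniq_leq_size (uniq_ball_seq r) _ => x.
by rewrite !mem_ball_seqE => /le_trans; apply.
Qed.

(** The summand [k + 1] forces [log_ball k > k], so that [2 ^ log_ball k] outgrows any constant even
    if the balls are small. *)
Definition log_ball k : nat := (up_log 2 (size (ball_seq (16 ^+ k))) + k + 1)%N.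

Lemma log_ball_gt k : (k < log_ball k)%N.
Proof. by rewrite /log_ball addn1 ltnS leq_addl. Qed.

Lemma log_ball_homo : {homo log_ball : i j / (i <= j)%N}.
Proof.
move=> i j ij; rewrite /log_ball leq_add2r leq_add // leq_up_log // size_ball_seq //.
by rewrite ler_weXn2l // ler1n.
Qed.

Lemma size_ball_log k : (size (ball_seq (16 ^+ k)) <= 2 ^ log_ball k)%N.
Proof.
apply: leq_trans (up_logP (size (ball_seq (16 ^+ k))) (ltnSn 1)) _.
by rewrite leq_exp2l // /log_ball -addnA leq_addr.
Qed.

(* Otherwise 256 ^ k / log_ball k is bounded, so that the term k + 1 in log_ball k is
   negligible, log_ball k <= 2 * log_2 |B(16 ^ k)| eventually, and the integral converges. *)
Lemma log_ball_diverges (A : R) :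
  exists n, A <= \sum_(k < n) 256 ^+ k / (log_ball k)%:R.
Proof.
apply: contrapT => /forallNP hA.
have {hA}hA n : \sum_(k < n) 256 ^+ k / (log_ball k)%:R < A.
  by rewrite ltNge; apply/negP; exact: hA.
have p256 : 0 < 256 :> R by rewrite ltr0n.
have p512 : 0 < 512 :> R by rewrite ltr0n.
have l2 := ln2_gt0.
have A0 : 0 < A by have := hA 0%N; rewrite big_ord0.
have L0 k : 0 < (log_ball k)%:R :> R by rewrite ltr0n (leq_trans _ (log_ball_gt k)).
have t0 k : 0 <= 256 ^+ k / (log_ball k)%:R :> R 
  by apply: divr_ge0; [apply: exprn_ge0; exact: ltW|exact: ltW].
have c0 : 0 <= 512 / ln 2 :> R by apply: divr_ge0; exact: ltW.
have e16 k : 0 <= 16 ^+ k :> R by rewrite exprn_ge0.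
have hk k : 256 ^+ k <= A * (log_ball k)%:R.
  rewrite -ler_pdivrMr //; apply/ltW/(le_lt_trans _ (hA k.+1)).
  by rewrite big_ord_recr /= lerDr sumr_ge0.
have [n0 hn0] := sqr_le_exp2 (A * 6).
pose k1 := n0.+1.
(* The series bound gives 6 k^2 <= [log_ball k], and 2 k + 4 <= 6 k^2 for k >= 1. *)
have large k : (k1 <= k)%N -> (2 * k + 4 <= log_ball k)%N.
  move=> kk; rewrite -(ler_nat R) -(ler_pM2l A0); apply: le_trans (hk k).
  have : A * 6 * k%:R ^+ 2 <= 2 ^+ k by apply: hn0; apply: ltnW.
  move=> h; apply: (@le_trans _ _ (2 ^+ k)); last first.
    by rewrite lerXn2r ?nnegrE ?(ltW p256) // ler_nat.
  apply: le_trans h; rewrite -mulrA ler_pM2l // natrD natrM.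
  have k1r : 1 <= k%:R :> R by rewrite ler1n (leq_trans _ kk).
  have : k%:R <= k%:R ^+ 2 :> R by rewrite expr2 ler_peMl.
  lra.
pose K : R := 16 ^+ k1 / ln 2.
have K0 : 0 <= K by rewrite divr_ge0 ?exprn_ge0 // ltW.
(* For 16^k <= x <= 16^(k + 1), the numerator is at most 16^(k + 1) and the logarithm at least
   [log_ball k] * ln 2 / 2. *)
pose beta k : R := 32 * 16 ^+ k / ((log_ball k)%:R * ln 2).
have beta0 k : 0 <= beta k by rewrite divr_ge0 ?mulr_ge0 ?exprn_ge0 // ltW.
pose bound := K * 16 ^+ k1 + 512 / ln 2 * A.
suff : (\int[mu]_(r in `[r0, +oo[) vq r <= bound%:E)%E by rewrite hint leye_eq.
apply: (@integral_le_cover _ _ _ (fun k => if k is j.+1 then beta j else K)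
  (fun k => if k is j.+1 then 16 ^+ j else 0)
  (fun k => if k is j.+1 then 16 ^+ j.+1 else 16 ^+ k1)) => //.
- by case.
- by case=> [|k]; rewrite ?exprn_ge0 // ler_weXn2l // ler1n.
- case=> [|n].
    rewrite big_ord0; apply: addr_ge0; apply: mulr_ge0 => //; exact: ltW.
  rewrite big_ord_recl subr0 /bound lerD2l.
  apply: (@le_trans _ _ (512 / ln 2 * \sum_(k < n) 256 ^+ k / (log_ball k)%:R)); last first.
    by apply: ler_wpM2l c0 _ _ _; exact: ltW.
  rewrite mulr_sumr; apply: ler_sum => k _ /=; rewrite /beta !add0n.
  apply: (@le_trans _ _ (32 * 16 ^+ k / ((log_ball k)%:R * ln 2) * 16 ^+ k.+1)).
    by rewrite ler_wpM2l //; [exact: beta0 | rewrite lerBlDr lerDl exprn_ge0].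
  have -> : 256 ^+ k = 16 ^+ k * 16 ^+ k :> R.
    by rewrite -exprMn -natrM.
  rewrite exprS le_eqVlt; apply/orP; left; apply/eqP; field.
  by rewrite !gt_eqF.
- move=> x /=; rewrite in_itv /= andbT => r0x.
  exact: volume_quotient_ge0 (lt_le_trans r0_gt0 r0x).
move=> x /=; rewrite in_itv /= andbT => r0x; have x_gt0 := lt_le_trans r0_gt0 r0x.
have [xr|rx] := leP x (16 ^+ k1).
  exists 0%N => /=; split; first by rewrite (ltW x_gt0).
  apply: (le_trans (volume_quotient_le_ln2 x_gt0)).
  by rewrite lee_fin ler_pM2r ?invr_gt0.
have [k [k1k xk]] : exists k, (k1 <= k)%N /\ 16 ^+ k <= x <= 16 ^+ k.+1.
  have ex : exists n, x <= 16 ^+ n.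
    exists (Num.truncn x).+1; apply: ltW; apply: (lt_le_trans (truncnS_gt x)).
    by rewrite -natrX ler_nat ltnW // ltn_expl.
  case: (ex_minnP ex) => n hn hmin.
  have n_gt : (k1 < n)%N.
    rewrite ltnNge; apply/negP => h; move: rx; rewrite ltNge => /negP; apply.
    by apply: (le_trans hn); rewrite ler_weXn2l // ler1n.
  exists n.-1; rewrite -ltnS prednK ?(leq_trans _ n_gt) //; split => //.
  rewrite hn andbT leNgt; apply/negP => /ltW /hmin.
  by rewrite leqNgt prednK ?leqnn // (leq_trans _ n_gt).
exists k.+1 => /=; split => //; have [xk1 xk2] := andP xk.
apply: (@le_trans _ _ (x / ((log_ball k)%:R / 2 * ln 2))%:E); last first.
  rewrite lee_fin /beta ler_pdivrMr ?mulr_gt0 ?invr_gt0 //.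
  rewrite [leRHS](_ : _ = 16 ^+ k.+1) // exprS; field.
  by rewrite !gt_eqF.
apply: volume_quotient_le => //; first by rewrite !mulr_gt0 ?invr_gt0.
move=> _ hs; set N := size (ball_seq (16 ^+ k)).
pose f := up_log 2 N.
have fL : (log_ball k <= 2 * f.-1)%N by exact: half_log_bound (large _ k1k).
have N1 : (1 < N)%N.
  rewrite ltnNge; apply/negP => hN; have : f = 0%N.
    by apply/eqP; rewrite /f up_log_eq0 hN orbT.
  by move=> f0; move: fL (log_ball_gt k); rewrite f0; case: (log_ball k).
have NN : (N <= size (ball_seq x))%N by exact: size_ball_seq.
apply: (@le_trans _ _ (ln N%:R)); last first.
  by rewrite ler_ln ?posrE ?ltr0n ?ler_nat // ?(leq_trans _ NN) // ltnW.
apply: (@le_trans _ _ (ln (2 ^+ f.-1))); last first.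
  rewrite ler_ln ?posrE ?exprn_gt0 ?ltr0n //; last exact: ltnW.
  by rewrite -natrX ler_nat ltnW // up_log_gtn.
rewrite lnXn // -[leRHS]mulr_natl ler_wpM2r ?(ltW l2) //.
by rewrite ler_pdivrMr // mulrC -natrM ler_nat.
Qed.

End volume.

(** * The jump chain and the Laplace transforms of the jump times *)

Lemma cvg_sum_seq (R : realType) (I : Type) (s : seq I) (F : I -> nat -> R) (l : I -> R) :
  (forall i, F i n @[n --> \oo] --> l i) ->
  (\sum_(i <- s) F i n) @[n --> \oo] --> \sum_(i <- s) l i.
Proof.
move=> h; elim: s => [|i s IH].
  by under eq_fun do rewrite big_nil; rewrite big_nil; exact: cvg_cst.
by under eq_fun do rewrite big_cons; rewrite big_cons; apply: cvgD.
Qed.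

Section jump_chain.
Variables (R : realType) (G : countType) (Gamma : weighted_graph R G).
Local Notation pi := (weight Gamma).
Local Notation q := (exit_rate Gamma).
Local Notation P := (jump_prob Gamma).

Lemma qmatrixE x y : x != y -> qmatrix Gamma x y = pi x y.
Proof.
move=> xy; rewrite /qmatrix /generator (negbTE xy).
have uS := undup_uniq (y :: nbr_seq Gamma x).
have mS z : (z \in undup (y :: nbr_seq Gamma x)) = (z == y) || adj Gamma x z.
  by rewrite mem_undup inE mem_nbr_seq.
move: (undup _) uS mS => S uS mS.
rewrite (@sum_nbrs _ _ _ (fun z => (z == y)%:R - 0) x S) // => [|z xz]; last first.
  by rewrite mS xz orbT.
rewrite (big_rem y) /=; last by rewrite mS eqxx.
rewrite eqxx subr0 mulr1 big_seq big1 ?addr0 // => z.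
rewrite mem_rem_uniq // !inE => /andP[/negbTE -> _].
by rewrite subr0 mulr0.
Qed.

Lemma uniq_nbr_seq x : uniq (nbr_seq Gamma x).
Proof. exact: finmap.fset_uniq. Qed.

Lemma exit_rateE x : q x = \sum_(y <- nbr_seq Gamma x) pi x y.
Proof.
rewrite /exit_rate /qmatrix /generator (@sum_nbrs _ _ _ _ x (nbr_seq Gamma x)).
- rewrite -sumrN big_seq [RHS]big_seq; apply: eq_bigr => y.
  rewrite mem_nbr_seq => xy; have -> : (y == x) = false.
    by apply/negP => /eqP yx; rewrite yx adj_irr in xy.
  by rewrite eqxx sub0r mulrN1 opprK.
- exact: uniq_nbr_seq.
- by move=> y; rewrite mem_nbr_seq.
Qed.

Lemma exit_rate_ge0 x : 0 <= q x.
Proof. by rewrite exit_rateE sumr_ge0 // => y _; exact: weight_ge0. Qed.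

Definition next_seq x := if q x == 0 then [:: x] else nbr_seq Gamma x.

Lemma uniq_next_seq x : uniq (next_seq x).
Proof. by rewrite /next_seq; case: ifP => // _; exact: uniq_nbr_seq. Qed.

Lemma jump_probE x y : q x != 0 -> P x y = pi x y / q x.
Proof.
move=> qx; rewrite /jump_prob (negbTE qx); case: eqVneq => [->|xy].
  by rewrite weight0 ?mul0r // adj_irr.
by rewrite qmatrixE.
Qed.

Lemma jump_prob_ge0 x y : 0 <= P x y.
Proof.
have [qx|qx] := eqVneq (q x) 0; first by rewrite /jump_prob qx eqxx.
by rewrite jump_probE // divr_ge0 ?weight_ge0 // exit_rate_ge0.
Qed.

Lemma sum_jump_prob x : \sum_(y <- next_seq x) P x y = 1.
Proof.
rewrite /next_seq; have [qx|qx] := eqVneq (q x) 0.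
  by rewrite big_seq1 /jump_prob qx eqxx eqxx.
under eq_bigr do rewrite jump_probE //.
by rewrite -mulr_suml -exit_rateE divff.
Qed.

(* The expectation of l (Y_0) * ... * l (Y_n) for the jump chain Y started at x. *)
Fixpoint chain_exp (l : G -> R) n x : R :=
  if n is n'.+1 then l x * \sum_(y <- next_seq x) P x y * chain_exp l n' y else l x.

Lemma chain_exp_ge0 l n x : (forall y, 0 <= l y) -> 0 <= chain_exp l n x.
Proof.
move=> l0; elim: n x => //= n IH x; rewrite mulr_ge0 // sumr_ge0 // => y _.
by rewrite mulr_ge0 // jump_prob_ge0.
Qed.

Lemma chain_exp_le l l' n x : (forall y, 0 <= l y <= l' y) ->
  chain_exp l n x <= chain_exp l' n x.
Proof.
move=> ll'; have l0 y : 0 <= l y by case/andP: (ll' y).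
have lel y : l y <= l' y by case/andP: (ll' y).
elim: n x => //= n IH x; apply: ler_pM => //.
  by rewrite sumr_ge0 // => y _; rewrite mulr_ge0 ?jump_prob_ge0 // chain_exp_ge0.
by apply: ler_sum => y _; rewrite ler_wpM2l ?jump_prob_ge0.
Qed.

Lemma chain_exp1 n x : chain_exp (fun=> 1) n x = 1.
Proof.
elim: n x => //= n IH x; rewrite mul1r.
by under eq_bigr do rewrite IH mulr1; exact: sum_jump_prob.
Qed.

Lemma cvg_chain_exp (l_ : nat -> G -> R) l n x :
  (forall y, l_ N y @[N --> \oo] --> l y) ->
  chain_exp (l_ N) n x @[N --> \oo] --> chain_exp l n x.
Proof.
move=> h; elim: n x => //= n IH x; apply: cvgM => //.
by apply: cvg_sum_seq => y; apply: cvgM; [exact: cvg_cst|exact: IH].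
Qed.

(** Laplace transform at 1 of the exponential law of parameter [q x]; rate 0 gives 0, in accordance
    with an infinite holding time. *)
Definition hold_laplace x : R := q x / (1 + q x).

Lemma hold_laplace_ge0 x : 0 <= hold_laplace x.
Proof. by have := exit_rate_ge0 x => h; rewrite divr_ge0 // addr_ge0. Qed.

Lemma hold_laplace_le1 x : hold_laplace x <= 1.
Proof.
have h := exit_rate_ge0 x.
by rewrite ler_pdivrMr ?ltr_wpDr // mul1r lerDr.
Qed.

Local Notation v := (chain_exp hold_laplace).

Lemma chain_exp_homo x : {homo (fun n => v n x) : n m / (n <= m)%N >-> m <= n}.
Proof.
suff h n y : v n.+1 y <= v n y.
  by apply: homo_leq => // a b c ba cb; exact: le_trans cb ba.
elim: n y => [|n IH] y /=.
  rewrite ler_piMr ?hold_laplace_ge0 // -[leRHS](sum_jump_prob y).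
  apply: ler_sum => z _; rewrite ler_piMr ?jump_prob_ge0 //; exact: hold_laplace_le1.
rewrite ler_wpM2l ?hold_laplace_ge0 //; apply: ler_sum => z _.
by rewrite ler_wpM2l ?jump_prob_ge0 //; exact: IH.
Qed.

Hypothesis bounded_eq0 : forall w : G -> R, (forall x, 0 <= w x <= 1) ->
  (forall x, generator Gamma w x = w x) -> forall x, w x = 0.

(** [v n x] is the mean of exp (- [jump_time n.+1]) from x. Its decreasing limit w satisfies w =
    [hold_laplace] * P w; multiplied by 1 + q this reads L w = w, so w = 0. *)
Lemma chain_exp_cvg0 x : v n x @[n --> \oo] --> (0 : R).
Proof.
have lb y : has_lbound (range (fun n => v n y)).
  by exists 0 => _ [n _ <-]; apply: chain_exp_ge0; exact: hold_laplace_ge0.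
pose w y := limn (fun n => v n y).
have cw y : v n y @[n --> \oo] --> w y.
  exact: nonincreasing_is_cvgn (@chain_exp_homo y) (lb y).
have w01 y : 0 <= w y <= 1.
  apply/andP; split.
    apply: limr_ge; first exact: cw.
    by near=> n; apply: chain_exp_ge0; exact: hold_laplace_ge0.
  apply: (@le_trans _ _ (v 0%N y)); last exact: hold_laplace_le1.
  exact: nonincreasing_cvgn_ge (@chain_exp_homo y) (cw y) 0%N.
have wE y : w y = hold_laplace y * \sum_(z <- next_seq y) P y z * w z.
  have h1 : v n.+1 y @[n --> \oo] --> w y.
    by have := cw y; rewrite -(cvg_shiftS (fun n => v n y)).
  have h2 : v n.+1 y @[n --> \oo] -->
      hold_laplace y * \sum_(z <- next_seq y) P y z * w z.
    apply: cvgM; first exact: cvg_cst.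
    by apply: cvg_sum_seq => z; apply: cvgM; [exact: cvg_cst|exact: cw].
  by rewrite -(cvg_lim _ h1) // (cvg_lim _ h2).
suff -> : 0 = w x by exact: cw.
apply/esym; apply: bounded_eq0 => // y.
rewrite /generator (@sum_nbrs _ _ _ (fun z => w z - w y) y (nbr_seq Gamma y)).
- under eq_bigr do rewrite mulrBr.
  rewrite sumrB -mulr_suml -exit_rateE.
  have q0 := exit_rate_ge0 y; have q1 : 1 + q y != 0 by rewrite gt_eqF // ltr_wpDr.
  suff -> : \sum_(z <- nbr_seq Gamma y) pi y z * w z = (1 + q y) * w y by ring.
  rewrite (wE y) /hold_laplace /next_seq.
  have [qy|qy] := eqVneq (q y) 0.
    rewrite qy mul0r mul0r mulr0 big_seq big1 // => z zn.
    suff -> : pi y z = 0 by rewrite mul0r.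
    apply/eqP; move/eqP: qy; rewrite exit_rateE psumr_eq0 => [/allP|t _]; last exact: weight_ge0.
    by move=> /(_ z zn).
  under [in RHS]eq_bigr do rewrite jump_probE // mulrAC.
  by rewrite -mulr_suml; field; rewrite qy.
- exact: uniq_nbr_seq.
- by move=> z; rewrite mem_nbr_seq.
Unshelve. all: by end_near. Qed.

End jump_chain.

(** * Means, and approximation of exp (- h) by step functions *)

Section mean.
Context (d : measure_display) (T : measurableType d) (R : realType).
Variable (mu : probability T R).

Definition has_mean (F : T -> R) (e : R) : Prop :=
  mu.-integrable [set: T] (EFin \o F) /\ (\int[mu]_w (F w)%:E = e%:E)%E.

Lemma has_mean_indic (A : set T) (a : R) : measurable A -> mu A = a%:E ->
  has_mean \1_A a.
Proof.
move=> mA muA; split; first exact: integrable_indic.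
by rewrite integral_indic // setIT.
Qed.

Lemma has_meanD F1 F2 e1 e2 : has_mean F1 e1 -> has_mean F2 e2 ->
  has_mean (fun w => F1 w + F2 w) (e1 + e2).
Proof.
move=> [i1 h1] [i2 h2]; split.
  by rewrite (_ : _ \o _ = (EFin \o F1) \+ (EFin \o F2))%E //; exact: integrableD.
by rewrite EFinD -h1 -h2 -integralD_EFin.
Qed.

Lemma has_meanZ c F e : has_mean F e -> has_mean (fun w => c * F w) (c * e).
Proof.
move=> [i h]; split.
  by rewrite (_ : _ \o _ = (fun w => c%:E * (EFin \o F) w)%E) //; exact: integrableZl.
by rewrite EFinM -h -(integralZl measurableT i).
Qed.

Lemma has_mean_sum (I : eqType) (s : seq I) (F : I -> T -> R) (e : I -> R) :
  (forall i, i \in s -> has_mean (F i) (e i)) ->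
  has_mean (fun w => \sum_(i <- s) F i w) (\sum_(i <- s) e i).
Proof.
elim: s => [|i s IH] h.
  rewrite big_nil (_ : (fun w => _) = \1_set0); last first.
    by apply/funext => w; rewrite big_nil indicE in_set0.
  by apply: has_mean_indic => //; exact: measure0.
rewrite big_cons (_ : (fun w => _) = (fun w => F i w + \sum_(j <- s) F j w)); last first.
  by apply/funext => w; rewrite big_cons.
apply: has_meanD; first by apply: h; rewrite mem_head.
by apply: IH => j js; apply: h; rewrite inE js orbT.
Qed.

Lemma measure_le_mean F e (B : set T) : has_mean F e -> measurable B ->
  (forall w, \1_B w <= F w) -> (mu B <= e%:E)%E.
Proof.
move=> [iF <-] mB h; rewrite -[leLHS](_ : \int[mu]_w (\1_B w)%:E = _)%E.
  apply: le_integral => //; first exact: integrable_indic.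
  by move=> w _; rewrite lee_fin.
by rewrite integral_indic // setIT.
Qed.

End mean.

Section staircase.
Variable R : realType.
Implicit Types (s r : R).

(* Jumps at 0, e, 2 e, ... of the step function equal to s ^ k on (k e, (k + 1) e]; for
   s = exp (- e) it dominates exp (- h). *)
Definition stair_coef s k : R := if k is j.+1 then s ^+ j.+1 - s ^+ j else 1.

(** [b k] stands for k e < h, so its true values form an initial segment and the sum telescopes to
    the power of [s] at the last true index up to K. In the third claim, [e] plays the part of exp
    (- h). *)
Lemma stair_sum s K (b : nat -> bool) : 0 <= s -> (forall k, b k.+1 -> b k) ->
  [/\ b K -> \sum_(k < K.+1) stair_coef s k * (b k)%:R = s ^+ K,
      0 <= \sum_(k < K.+1) stair_coef s k * (b k)%:R &
      forall e, b 0%N -> (forall k, b k -> e <= s ^+ k) ->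
        e <= \sum_(k < K.+1) stair_coef s k * (b k)%:R].
Proof.
move=> s0 hb; elim: K => [|K [IH1 IH2 IH3]].
  rewrite big_ord1 /= mul1r; split; [by move=> ->|exact: ler0n|].
  by move=> e b0 /(_ _ b0); rewrite b0.
rewrite big_ord_recr /=; have [bK|bK] := boolP (b K.+1).
  rewrite (IH1 (hb _ bK)) mulr1 addrC subrK; split => //; first exact: exprn_ge0.
  by move=> e _; apply.
by rewrite mulr0 addr0; split.
Qed.

(** [r ^+ k] is the probability that an exponential variable exceeds k steps. The full series is
    geometric with sum (1 - r) / (1 - s r); [s ^+ K] bounds the truncation. *)
Lemma stair_laplace s r K : 0 <= s -> s < 1 -> 0 <= r -> r <= 1 ->
  0 <= \sum_(k < K.+1) stair_coef s k * r ^+ k <= (1 - r) / (1 - s * r) + s ^+ K.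
Proof.
move=> s0 s1 r0 r1.
have sr1 : s * r < 1 by apply: le_lt_trans s1; rewrite ler_piMr.
have sr0 : 0 < 1 - s * r by rewrite subr_gt0.
have h : (\sum_(k < K.+1) stair_coef s k * r ^+ k) * (1 - s * r) =
    (1 - r) + (1 - s) * r * (s * r) ^+ K.
  elim: K => [|K IH]; first by rewrite big_ord1 /= !expr0; ring.
  by rewrite big_ord_recr mulrDl IH /= !exprMn !exprS; ring.
apply/andP; split.
  rewrite -(pmulr_lge0 _ sr0) h; apply: addr_ge0; first by rewrite subr_ge0.
  by rewrite !(mulr_ge0, exprn_ge0) // subr_ge0 ltW.
rewrite -(ler_pM2r sr0) h [leRHS]mulrDl divfK ?gt_eqF // lerD2l.
rewrite mulrC; apply: ler_pM; rewrite ?mulr_ge0 ?exprn_ge0 ?mulr_ge0 ?subr_ge0 // ?(ltW s1) //.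
  by rewrite lerXn2r ?nnegrE ?mulr_ge0 // ler_piMr.
by rewrite mulrBl mul1r lerD2r.
Qed.

Definition mesh N : R := N.+1%:R^-1.

(** Mean of the staircase at an exponential variable of parameter q. With (N + 1)^2 steps of size 1
    / (N + 1), both its range and its resolution grow with N. *)
Definition stair_exp N (q : R) : R :=
  \sum_(k < (N.+1 ^ 2).+1)
    stair_coef (expR (- mesh N)) k * expR (- (q * (k%:R * mesh N))).

(** In the error, [q * mesh N] comes from the discretization and [mesh N] from the truncation, which
    costs exp (- (N + 1)). *)
Lemma stair_exp_le N q : 0 <= q ->
  0 <= stair_exp N q <= q / (1 + q) + (q + 1) * mesh N.
Proof.
move=> q0; rewrite /stair_exp; set e := mesh N.
have e0 : 0 < e by rewrite invr_gt0 ltr0n.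
set s := expR (- e); set r := expR (- (q * e)).
have rE k : expR (- (q * (k%:R * e))) = r ^+ k.
  by rewrite /r -expRM_natr; congr expR; ring.
under eq_bigr do rewrite rE.
have s0 : 0 <= s by exact: expR_ge0.
have s1 : s < 1 by rewrite expR_lt1 oppr_lt0.
have r0 : 0 <= r by exact: expR_ge0.
have r1 : r <= 1 by rewrite expR_le1 oppr_le0 mulr_ge0 // ltW.
have /andP[-> h] /= := stair_laplace (N.+1 ^ 2) s0 s1 r0 r1; apply: (le_trans h).
have q1 : 0 < 1 + q by rewrite ltr_wpDr.
have inv_exp (x : R) : 0 <= x -> expR (- x) <= (1 + x)^-1.
  move=> x0; rewrite expRN lef_pV2 ?posrE ?expR_gt0 ?expR_ge1Dx //.
  by rewrite ltr_wpDr.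
rewrite [in leRHS]mulrDl mul1r addrA; apply: lerD.
  have sr0 : 0 < 1 - s * r.
    by rewrite subr_gt0 (le_lt_trans _ s1) // ler_piMr.
  have hr : 1 - r <= q * e.
    by have := expR_ge1Dx (- (q * e)); rewrite -/r; lra.
  have hsr : s * r <= (1 + (1 + q) * e)^-1.
    rewrite /s /r -expRD (_ : - e + _ = - ((1 + q) * e)); last by ring.
    by apply: inv_exp; rewrite mulr_ge0 ?(ltW q1) // ltW.
  have x1 : 0 < 1 + (1 + q) * e by rewrite addr_gt0 // mulr_gt0.
  have hsr' : (1 + q) * e / (1 + (1 + q) * e) <= 1 - s * r.
    have -> : (1 + q) * e / (1 + (1 + q) * e) = 1 - (1 + (1 + q) * e)^-1.
      by field; rewrite gt_eqF.
    by rewrite lerD2l lerN2.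
  rewrite ler_pdivrMr //.
  have c0 : 0 <= q / (1 + q) + q * e by rewrite addr_ge0 ?mulr_ge0 ?invr_ge0 // ltW.
  apply: le_trans (ler_wpM2l c0 hsr'); apply: (le_trans hr).
  rewrite le_eqVlt; apply/orP; left; apply/eqP; field.
  by rewrite !gt_eqF.
rewrite /s -expRM_natr natrX (_ : - e * _ = - (N.+1%:R : R)); last first.
  by rewrite /e /mesh; field; rewrite gt_eqF // ltr_wpDr.
apply: (le_trans (inv_exp _ (ler0n _ _))).
by rewrite lef_pV2 ?posrE ?ltr_wpDr ?ltr0n // lerDr.
Qed.

End staircase.

(** * Finite trajectories and the law of the jump times *)

Section trajectories.
Variables (R : realType) (G : countType) (Gamma : weighted_graph R G).
Local Notation q := (exit_rate Gamma).
Local Notation P := (jump_prob Gamma).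

Fixpoint trajectories n x : seq (seq G) :=
  if n is n'.+1 then [seq x :: p | y <- next_seq Gamma x, p <- trajectories n' y]
  else [:: [:: x]].

Lemma trajectoriesP n x p : p \in trajectories n x -> size p = n.+1 /\ head x p = x.
Proof.
elim: n x p => [|n IH] x p /=; first by rewrite inE => /eqP ->.
by move=> /allpairsPdep[y [p' [_ /IH[sp _] ->]]] /=; rewrite sp.
Qed.

Lemma uniq_trajectories n x : uniq (trajectories n x).
Proof.
elim: n x => [//|n IH] x /=; apply: allpairs_uniq_dep.
- exact: uniq_next_seq.
- by move=> y _; exact: IH.
- move=> _ _ /allpairsPdep[y1 [p1 [_ h1 ->]]] /allpairsPdep[y2 [p2 [_ h2 ->]]] /= [e].
  rewrite {}e in h1 *.
  by have [[_ <-] [_ <-]] := (trajectoriesP h1, trajectoriesP h2); case: p2 h1 h2 => [|? ?] /trajectoriesP[].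
Qed.

Definition traj_weight (l : G -> R) n (y : nat -> G) : R :=
  (\prod_(i < n) P (y i) (y i.+1)) * \prod_(i < n.+1) l (y i).

Lemma sum_traj_weight l n z x :
  \sum_(p <- trajectories n x) traj_weight l n (nth z p) = chain_exp Gamma l n x.
Proof.
elim: n x => [|n IH] x /=.
  by rewrite big_seq1 /traj_weight big_ord0 big_ord1 mul1r.
rewrite big_allpairs_dep mulr_sumr; apply: eq_bigr => y _.
rewrite -IH !mulr_sumr big_seq [RHS]big_seq; apply: eq_bigr => p hp.
have [sp hd] := trajectoriesP hp.
have p0 : nth z p 0 = y by case: p sp hd {hp}.
rewrite /traj_weight big_ord_recl [X in _ * X]big_ord_recl /= p0.
ring.
Qed.

End trajectories.

Section explosion.
Variables (R : realType) (G : countType) (Gamma : weighted_graph R G).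
Local Notation q := (exit_rate Gamma).
Local Notation P := (jump_prob Gamma).
Variable X : vsrw Gamma.
Local Notation Om := (Omega X).

Definition cylinder n (y : nat -> G) (t : nat -> R) : set Om :=
  [set w | forall i, (i <= n)%N -> jump i w = y i /\ ((t i)%:E < hold i w)%E].

Lemma measurable_cylinder n y t : measurable (cylinder n y t).
Proof.
rewrite (_ : cylinder n y t = \bigcap_(i in `I_n.+1)
    ([set w | jump i w = y i] `&` [set w | ((t i)%:E < hold i w)%E])); last first.
  by apply/seteqP; split=> w h i; exact: h.
apply: bigcap_measurable => [|i _]; first by exists 0%N.
 apply: measurableI; first exact: jump_measurable.
rewrite -[X in measurable X]setTI; apply: measurable_lte => //; exact: hold_measurable.
Qed.

Lemma prob_cylinder x n y t : (forall i, 0 <= t i) ->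
  Prob X x (cylinder n y t) = ((y 0%N == x)%:R * (\prod_(i < n) P (y i) (y i.+1))
       * \prod_(i < n.+1) expR (- (q (y i) * t i)))%:E.
Proof. exact: vsrw_law. Qed.

Lemma measurable_jump_time n : measurable_fun [set: Om] (@jump_time _ _ _ X n).
Proof. by apply: emeasurable_sum => i; exact: hold_measurable. Qed.

Lemma measurable_jump_time_le n (t : R) : measurable [set w : Om | (jump_time n w <= t%:E)%E].
Proof.
rewrite -[X in measurable X]setTI; apply: measurable_lee => //.
exact: measurable_jump_time.
Qed.

Lemma hold_fin n (t : R) (w : Om) : (jump_time n.+1 w <= t%:E)%E ->
  exists2 h : nat -> R, (forall i, (i <= n)%N -> hold i w = (h i)%:E) &
    \sum_(i < n.+1) h i <= t.
Proof.
move=> ht; exists (fun i => fine (hold i w)) => [i le_in|].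
  have hi : (hold i w <= t%:E)%E.
    apply: le_trans ht; rewrite /jump_time (bigD1 (Ordinal (le_in : (i < n.+1)%N))) //=.
    by rewrite leeDl // sume_ge0 // => j _; exact: hold_ge0.
  by rewrite fineK // ge0_fin_numE ?hold_ge0 // (le_lt_trans hi) // ltry.
rewrite -lee_fin -sumEFin; apply: le_trans ht; rewrite /jump_time.
apply: lee_sum => i _; have := hold_ge0 i w; case: (hold i w) => //= _; exact: leey.
Qed.

(** Markov's inequality for exp (- [jump_time n.+1]), with each exp (- h) replaced by its staircase.
    In the expanded product, [f] selects one step for each holding time. *)
Lemma prob_jump_time_le x n (t : R) N :
  (Prob X x [set w | (jump_time n.+1 w <= t%:E)%E] <=
   (expR t * chain_exp Gamma (fun y => stair_exp N (q y)) n x)%:E)%E.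
Proof.
pose K := (N.+1 ^ 2)%N; pose e : R := mesh R N; pose s := expR (- e).
have e0 : 0 < e by rewrite invr_gt0 ltr0n.
pose tr := trajectories Gamma n x.
pose c (f : {ffun 'I_n.+1 -> 'I_K.+1}) : R := \prod_i stair_coef s (f i).
pose tm (f : {ffun 'I_n.+1 -> 'I_K.+1}) i : R := (f (inord i))%:R * e.
(* The first two summands are 1 off the cylinders with positive holding times along a listed
   trajectory, and 0 on them. They have mean 0, since the probabilities of the trajectories add up
   to 1. *)
pose F w : R := 1 + - 1 * (\sum_(p <- tr) \1_(cylinder n (nth x p) (fun=> 0)) w) +
  expR t * \sum_(p <- tr) \sum_f c f * \1_(cylinder n (nth x p) (tm f)) w.
have tm0 f i : 0 <= tm f i by rewrite mulr_ge0 ?ler0n // ltW.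
have head_tr p : p \in tr -> nth x p 0 = x.
  by move=> /trajectoriesP[]; case: p.
have mean0 p : p \in tr -> has_mean (Prob X x) \1_(cylinder n (nth x p) (fun=> 0))
    (traj_weight Gamma (fun=> 1) n (nth x p)).
  move=> ptr; apply: has_mean_indic; first exact: measurable_cylinder.
  rewrite prob_cylinder // head_tr // eqxx mul1r /traj_weight.
  by congr ((_ * _)%:E); apply: eq_bigr => i _; rewrite mulr0 oppr0 expR0.
have mean1 p : p \in tr ->
    has_mean (Prob X x) (fun w => \sum_f c f * \1_(cylinder n (nth x p) (tm f)) w)
      (traj_weight Gamma (fun y => stair_exp N (q y)) n (nth x p)).
  move=> ptr; rewrite /traj_weight /stair_exp.
  rewrite (bigA_distr_bigA (fun (i : 'I_n.+1) (k : 'I_K.+1) => stair_coef s k *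
    expR (- (q (nth x p i) * (k%:R * e))))) /= mulr_sumr.
  apply: has_mean_sum => f _.
  rewrite big_split /= mulrCA; apply: has_meanZ.
  apply: has_mean_indic; first exact: measurable_cylinder.
  rewrite prob_cylinder // head_tr // eqxx mul1r.
  by congr ((_ * _)%:E); apply: eq_bigr => i _; rewrite /tm inord_val.
have meanF : has_mean (Prob X x) F
    (1 + - 1 * 1 + expR t * chain_exp Gamma (fun y => stair_exp N (q y)) n x).
  apply: has_meanD.
    apply: has_meanD.
      have := @has_mean_indic _ _ _ (Prob X x) setT 1 measurableT (probability_setT _).
      by rewrite indicT.
    apply: has_meanZ; rewrite -[X in has_mean _ _ X](chain_exp1 Gamma n x).
    rewrite -(sum_traj_weight _ _ _ x); exact: has_mean_sum.
  by apply: has_meanZ; rewrite -(sum_traj_weight _ _ _ x); exact: has_mean_sum.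
rewrite mulr1 subrr add0r in meanF.
apply: measure_le_mean meanF _ _; first exact: measurable_jump_time_le.
move=> w.
pose b p i k := `[< jump i w = nth x p i /\ ((k%:R * e)%:E < hold i w)%E >].
have b_decr p i k : b p i k.+1 -> b p i k.
  move=> /asboolP[h1 h2]; apply/asboolP; split=> //; apply: le_lt_trans h2.
  by rewrite lee_fin ler_pM2r // ler_nat.
have s0 : 0 <= s by exact: expR_ge0.
pose stair p i := \sum_(k < K.+1) stair_coef s k * (b p i k)%:R.
have sumE p : \sum_f c f * \1_(cylinder n (nth x p) (tm f)) w = \prod_(i < n.+1) stair p i.
  rewrite (bigA_distr_bigA (fun (i : 'I_n.+1) (k : 'I_K.+1) => stair_coef s k * (b p i k)%:R)).
  apply: eq_bigr => f _; rewrite big_split /= -/(c f); congr (_ * _).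
  rewrite indicE; have [h|h] := boolP (w \in _).
    rewrite big1 // => i _; rewrite /b asboolT //.
    have := set_mem h i; rewrite -ltnS ltn_ord => /(_ isT).
    by rewrite /tm inord_val.
  apply/esym/eqP/prodf_eq0; apply: contrapT => h'.
  move/negP: h; apply; apply/mem_set => i.
  rewrite -ltnS => il; have := contra_not (fun z => ex_intro2 _ _ (Ordinal il) isT z) h' => /=.
  rewrite /tm (_ : inord i = Ordinal il); last by apply: val_inj; rewrite /= inordK.
  case E : (b p i _); first by move=> _; exact/asboolP.
  by rewrite eqxx => /(_ isT).
have stair0 p i : 0 <= stair p i by have [] := stair_sum K s0 (b_decr p i).
have prod0 p : 0 <= \prod_(i < n.+1) stair p i by exact: prodr_ge0.
have sumprod0 : 0 <= \sum_(p <- tr) \prod_(i < n.+1) stair p i by exact: sumr_ge0.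
have B1 : \1_[set w : Om | (jump_time n.+1 w <= t%:E)%E] w <= 1 :> R.
  by rewrite indicE; case: (_ \in _).
rewrite /F; under [X in _ <= _ + expR t * X]eq_bigr do rewrite sumE.
have [/hasP[p ptr wp]|/hasPn none] := boolP (has (fun p => w \in cylinder n (nth x p) (fun=> 0)) tr);
    last first.
  rewrite big_seq big1 ?mulr0 ?addr0 => [|p ptr]; last by rewrite indicE (negbTE (none p ptr)).
  by apply: (le_trans B1); rewrite lerDl mulr_ge0 ?expR_ge0.
have cyl_p := set_mem wp.
have -> : \sum_(p' <- tr) \1_(cylinder n (nth x p') (fun=> 0)) w = 1 :> R.
  rewrite (bigD1_seq p) ?uniq_trajectories //= indicE wp big_seq_cond big1 ?addr0 //.
  move=> p' /andP[p'tr p'p]; rewrite indicE; case: (boolP (w \in _)) => // /set_mem cyl_p'.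
  case/negP: p'p; apply/eqP; apply: (@eq_from_nth _ x).
    by rewrite (trajectoriesP ptr).1 (trajectoriesP p'tr).1.
  move=> i; rewrite (trajectoriesP p'tr).1 ltnS => il.
  by rewrite -(cyl_p i il).1 -(cyl_p' i il).1.
rewrite mulr1 subrr add0r indicE; case: (boolP (w \in _)) => [/set_mem /= wt|_]; last first.
  by rewrite mulr_ge0 ?expR_ge0.
have [h hE hsum] := hold_fin wt.
apply: (@le_trans _ _ (expR t * \prod_(i < n.+1) stair p i)); last first.
  rewrite ler_wpM2l ?expR_ge0 // (bigD1_seq p) ?uniq_trajectories //= lerDl.
  exact: sumr_ge0.
have hp : expR (- t) <= \prod_(i < n.+1) stair p i.
  apply: (@le_trans _ _ (\prod_(i < n.+1) expR (- h i))).
    by rewrite -expR_sum ler_expR sumrN lerN2.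
  apply: ler_prod => i _; rewrite expR_ge0 /=.
  have il : (i <= n)%N by rewrite -ltnS.
  have [_ _ ge_stair] := stair_sum K s0 (b_decr p i); apply: ge_stair.
    by apply/asboolP; rewrite mul0r; exact: cyl_p.
  move=> k /asboolP[_]; rewrite hE // lte_fin => kh.
  by rewrite /s -expRM_natr ler_expR mulNr lerN2 mulrC ltW.
apply: (@le_trans _ _ (expR t * expR (- t))); first by rewrite -expRD subrr expR0.
by rewrite ler_wpM2l ?expR_ge0.
Qed.


End explosion.

(** * No explosion, and total mass one *)

Section completeness.
Variables (R : realType) (G : countType) (Gamma : weighted_graph R G).
Hypothesis bounded_eq0 : forall w : G -> R, (forall x, 0 <= w x <= 1) ->
  (forall x, generator Gamma w x = w x) -> forall x, w x = 0.
Variable X : vsrw Gamma.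
Local Notation Om := (Omega X).
Local Notation q := (exit_rate Gamma).

Lemma prob_jump_time_le_laplace x n (t : R) :
  (Prob X x [set w | (jump_time n.+1 w <= t%:E)%E] <=
   (expR t * chain_exp Gamma (hold_laplace Gamma) n x)%:E)%E.
Proof.
pose l N y := hold_laplace Gamma y + (q y + 1) * mesh R N.
have cl y : l N y @[N --> \oo] --> hold_laplace Gamma y.
  rewrite -[X in _ --> X]addr0 -(mulr0 (q y + 1)).
  apply: cvgD; first exact: cvg_cst.
  by apply: cvgM; [exact: cvg_cst|exact: cvg_harmonic].
have h N : (Prob X x [set w | (jump_time n.+1 w <= t%:E)%E] <=
   (expR t * chain_exp Gamma (l N) n x)%:E)%E.
  apply: le_trans (prob_jump_time_le X x n t N) _.
  rewrite lee_fin ler_wpM2l ?expR_ge0 //; apply: chain_exp_le => y.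
  exact: stair_exp_le (exit_rate_ge0 Gamma y).
have c : (expR t * chain_exp Gamma (l N) n x)%:E @[N --> \oo] -->
    (expR t * chain_exp Gamma (hold_laplace Gamma) n x)%:E.
  apply: cvg_EFin; first by near=> N.
  by apply: cvgM; [exact: cvg_cst|exact: cvg_chain_exp].
rewrite -(cvg_lim _ c) //; apply: lime_ge; first by apply/cvg_ex; eexists; exact: c.
by near=> N.
Unshelve. all: by end_near. Qed.

Lemma measurable_explosion (t : R) :
  measurable [set w : Om | forall n, (jump_time n w <= t%:E)%E].
Proof.
rewrite (_ : [set _ | _] = \bigcap_n [set w : Om | (jump_time n w <= t%:E)%E]).
  by apply: bigcapT_measurable => n; exact: measurable_jump_time_le.
by apply/seteqP; split=> w h n; [move=> _; exact: h|exact: (h n I)].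
Qed.

Lemma prob_explosion x (t : R) : Prob X x [set w | forall n, (jump_time n w <= t%:E)%E] = 0%E.
Proof.
have mE := measurable_explosion t.
apply/eqP; rewrite eq_le measure_ge0 andbT.
have c : (expR t * chain_exp Gamma (hold_laplace Gamma) n x)%:E @[n --> \oo] --> 0%E.
  apply: cvg_EFin; first by near=> N.
  rewrite -(mulr0 (expR t)).
  by apply: cvgM; [exact: cvg_cst|exact: chain_exp_cvg0].
rewrite -(cvg_lim _ c) //; apply: lime_ge; first by apply/cvg_ex; eexists; exact: c.
near=> n; apply: le_trans (prob_jump_time_le_laplace x n t).
by apply: le_measure; rewrite ?inE //; exact: measurable_jump_time_le || move=> w; exact.
Unshelve. all: by end_near. Qed.

Lemma jump_time_homo (w : Om) : {homo (fun n => jump_time n w) : m n / (m <= n)%N >-> (m <= n)%E}.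
Proof.
apply: homo_leq => // [a b c|n]; first exact: le_trans.
by rewrite /jump_time big_ord_recr /= leeDl // hold_ge0.
Qed.

(** The jump times are nondecreasing, so the index n is unique and [xget] can only return it. *)
Lemma position_SomeP (t : R) (w : Om) y : position t w = Some y <->
  exists n, (jump_time n w <= t%:E < jump_time n.+1 w)%E /\ jump n w = y.
Proof.
rewrite /position; set now := [set n | _]; split.
  by case: asboolP => // hn [<-]; exists (xget 0%N now).
move=> [n [hn <-]].
have nown : now n by [].
have eqn : xget 0%N now = n.
  have hx := xgetPex 0%N (ex_intro _ n nown).
  move: hn hx; move: (xget _ _) => k /andP[h1 h2] /= /andP[h3 h4].
  apply/eqP; rewrite eqn_leq; apply/andP; split; rewrite leqNgt; apply/negP => h.
    by have := lt_le_trans h2 (le_trans (jump_time_homo w h) h3); rewrite ltxx.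
  by have := lt_le_trans h4 (le_trans (jump_time_homo w h) h1); rewrite ltxx.
by rewrite eqn asboolT.
Qed.

Lemma measurable_position (t : R) y : measurable [set w : Om | position t w = Some y].
Proof.
rewrite (_ : [set _ | _] = \bigcup_n ([set w : Om | (jump_time n w <= t%:E)%E] `&`
    ~` [set w : Om | (jump_time n.+1 w <= t%:E)%E] `&` [set w : Om | jump n w = y])).
  apply: bigcupT_measurable => n; apply: measurableI; last exact: jump_measurable.
  by apply: measurableI; [|apply: measurableC]; exact: measurable_jump_time_le.
apply/seteqP; split=> w.
  move=> /position_SomeP[n [/andP[h1 h2] h3]]; exists n => //; split=> //; split=> //=.
  by apply/negP; rewrite -ltNge.
move=> [n _ [[/= h1 /negP h2] h3]]; apply/position_SomeP; exists n; split=> //.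
by rewrite h1 ltNge.
Qed.

Lemma position_None (t : R) (w : Om) : 0 <= t -> position t w = None ->
  forall n, (jump_time n w <= t%:E)%E.
Proof.
move=> t0 hw; elim=> [|n IH]; first by rewrite /jump_time big_ord0 lee_fin.
rewrite leNgt; apply/negP => h.
have : position t w = Some (jump n w).
  by apply/position_SomeP; exists n; rewrite IH.
by rewrite hw.
Qed.

Lemma esum_transition (t : R) x : 0 <= t ->
  (\esum_(y in [set: G]) transition X t x y = 1)%E.
Proof.
move=> t0.
(* Coding states by integers makes the sum over G a series of probabilities of disjoint events; what
   they leave out lies in the explosion event, of probability 0. *)
pose F n := [set w : Om | omap pickle (position t w) = Some n].
have FE y : F (pickle y) = [set w : Om | position t w = Some y].
  apply/seteqP; split=> w /=; rewrite /F /=; last by move=> ->.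
  by case: (position t w) => //= z [] /(pcan_inj (@pickleK G)) ->.
have D_F n : range (@pickle G) n -> measurable (F n).
  by move=> [y _ <-]; rewrite FE; exact: measurable_position.
transitivity (\esum_(n in range (@pickle G)) Prob X x (F n))%E.
  rewrite (@reindex_esum _ _ _ [set: G] _ pickle).
    by apply: eq_esum => y _; rewrite FE.
  by split=> // y z _ _ /(pcan_inj (@pickleK G)).
rewrite (_ : range _ = [set n | n \in range (@pickle G)]); last first.
  by apply/seteqP; split=> n /=; rewrite inE.
rewrite -nneseries_esum // -measure_bigcup //; last first.
  by move=> i j _ _ [w [hi hj]]; apply: Some_inj; rewrite -hi -hj.
have mE := measurable_explosion t.
have mF : measurable (\bigcup_(n in range (@pickle G)) F n) by exact: bigcup_measurable.
apply/eqP; rewrite eq_le probability_le1 //=.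
apply: (le_trans _ (le_trans (measureU2 (Prob X x) mF mE) _)); last first.
  by rewrite [X in (_ + X)%E](prob_explosion x t) adde0.
rewrite -(probability_setT (Prob X x)).
apply: le_measure; rewrite ?inE //; first exact: measurableU.
move=> w _; case hw : (position t w) => [y|]; [left|right].
  by exists (pickle y); [exists y|rewrite FE].
exact: position_None.
Qed.

End completeness.

Lemma induced_dist_adj (R : realType) (G : countType) (Gamma : weighted_graph R G)
    (alpha : G -> G -> R) (x y : G) :
  adj Gamma x y -> induced_dist Gamma alpha x y <= Num.sqrt (alpha x y).
Proof.
move=> xy; apply: ge_inf; last first.
  by exists [:: y]; rewrite /= ?xy // /path_length /= big_seq1.
by exists 0 => _ [p _ <-]; apply: sumr_ge0 => e _; exact: sqrtr_ge0.
Qed.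

Theorem theorem5p4 (R : realType) (G : countType) (Gamma : weighted_graph R G)
  (alpha : G -> G -> R) (halpha : is_edge_weight Gamma alpha)
  (hadapted : adapted Gamma alpha)
  (hbounded : exists2 D : R, 0 < D &
     forall x y, adj Gamma x y -> alpha x y <= D)
  (rho : G -> G -> R) (hrho : is_metric rho)
  (hrho_le : forall x y, rho x y <= induced_dist Gamma alpha x y)
  (hvolume : exists (x0 : G) (r0 : R), 0 < r0 /\
     (\int[lebesgue_measure]_(r in `[r0, +oo[) volume_quotient rho x0 r
      = +oo)%E) :
  stochastically_complete Gamma.
Proof.
have [x0 [r0 [r0_gt0 hint]]] := hvolume; have [C C0 hC] := hadapted.
move=> X t x t0; apply: esum_transition t0 => w w01 hw.
apply: (@bounded_solution_eq0 _ _ _ alpha (C + 1) (rho x0) halpha _ _ _ _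
  (log_ball rho x0) (fun k => ball_seq rho x0 (16 ^+ k))) => //.
- by rewrite ltr_wpDl.
- by move=> y; rewrite (le_trans (hC y)) // lerDl.
- exact: Defs.metric_ge0 hrho x0.
(* The increment of [rho x0] is at most [rho y z], hence at most the length [Num.sqrt (alpha y z)]
   of the edge. *)
- move=> y z yz.
  have a0 := ltW (edge_weight_gt0 halpha yz).
  rewrite -[leRHS](sqr_sqrtr a0) -[leLHS](real_normK (num_real _)) lerXn2r ?nnegrE ?sqrtr_ge0 //.
  apply: le_trans (le_trans (hrho_le y z) (induced_dist_adj alpha yz)).
  rewrite ler_norml; have := Defs.metric_triangle hrho x0 y z.
  by have := Defs.metric_triangle hrho x0 z y; rewrite (Defs.metric_sym hrho z y); lra.
- exact: log_ball_gt.
- exact: (log_ball_homo hrho r0_gt0 hint).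
- by move=> k y yk; rewrite (mem_ball_seqE hrho r0_gt0 hint).
- by move=> k; exact: size_ball_log.
- exact: (log_ball_diverges hrho r0_gt0 hint).
Qed.
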